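(* Let $\varphi\in\mathbf N[\alpha,\beta]$ be represented by a probability measure with infinite support, and let the sequence $\{z_k\}_{k=0}^\infty\subset\mathbb C_+$ satisfy, for some $\delta>0$, the condition $\operatorname{Im}z_k>\delta$ for $k=0,1,2,\dots$. Then the sequence of multipoint Padé approximants $f^{[n/n]}=R_n$ converges to $\varphi$ as $n\to\infty$ locally uniformly in $\mathbb C\setminus[\alpha,\beta]$.
   Context: $\alpha<\beta$ are real numbers and $\mathbb C_+$ is the open upper half plane. $\mathbf N[\alpha,\beta]$ is the class of functions $\varphi(\lambda)=\int_\alpha^\beta\frac{d\sigma(t)}{t-\lambda}$ with $\sigma$ a finite nonzero positive Borel measure on $[\alpha,\beta]$. Put $\varphi_0=\varphi$. Recursively for $j=0,1,2,\dots$ there are uniquely determined numbers $a_j^{(1)},a_j^{(2)}\in\mathbb R$, $b_j>0$ and a function $\varphi_{j+1}\in\mathbf N[\alpha,\beta]$ represented by a probability measure such that $$\varphi_j(\lambda)=-\frac{1}{a_j^{(2)}\lambda-a_j^{(1)}+b_j^2(\lambda-z_j)(\lambda-\overline z_j)\varphi_{j+1}(\lambda)} .$$ (The process never stops because the support of the measure of $\varphi$ is infinite.) $R_n$ is the $(n+1)$-th convergent of the resulting continued fraction, $$R_n(\lambda)=-\cfrac{1}{a_0^{(2)}\lambda-a_0^{(1)}-\cfrac{b_0^2(\lambda-z_0)(\lambda-\overline z_0)}{a_1^{(2)}\lambda-a_1^{(1)}-\cdots-\cfrac{b_{n-1}^2(\lambda-z_{n-1})(\lambda-\overline z_{n-1})}{a_n^{(2)}\lambda-a_n^{(1)}}}}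 ,$$ that is, $R_n=R_{0,n}$ where $R_{n,n}(\lambda)=-\frac{1}{a_n^{(2)}\lambda-a_n^{(1)}}$ and $R_{j,n}(\lambda)=-\frac{1}{a_j^{(2)}\lambda-a_j^{(1)}+b_j^2(\lambda-z_j)(\lambda-\overline z_j)R_{j+1,n}(\lambda)}$ for $0\le j<n$. It is a real rational function, and it is the $[n/n]$ multipoint Padé approximant $f^{[n/n]}$ for $\varphi$ at the points $\{\infty,z_0,\overline z_0,\dots,z_n,\overline z_n,\dots\}$; here the $[L/M]$ multipoint Padé approximant at points $\{\alpha_k\}_{k\ge1}$ is a ratio of two polynomials of formal degrees $L$ and $M$ which agrees with $\varphi$ at $\alpha_1,\dots,\alpha_{L+M+1}$. *)

(* Defs.v *)
From HB Require Import structures.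
From mathcomp Require Export all_boot all_order all_algebra.
From mathcomp Require Export complex.
From mathcomp Require Export all_classical all_reals all_analysis.
Set Implicit Arguments.
Unset Strict Implicit.
Unset Printing Implicit Defensive.
Export Order.TTheory GRing.Theory Num.Theory numFieldNormedType.Exports.

Local Open Scope classical_set_scope.
Local Open Scope ring_scope.
Local Open Scope complex_scope.

(* The topology and uniformity of R[i] given by its modulus. *)
HB.instance Definition _ (R : realType) :=
  PseudoPointedMetric.copy R[i] R[i]^o.

Section Defs.
Context {R : realType}.

Definition off_segment (alpha beta : R) : set R[i] :=
  ~` [set t%:C | t in `[alpha, beta]].

Definition complex_integral (mu : {measure set (measurableTypeR R) -> \bar R})
    (D : set R) (f : R -> R[i]) : R[i] :=
  (\int[mu]_(t in D) complex.Re (f t)) +i* (\int[mu]_(t in D) complex.Im (f t)).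

(* Functions of the class N[alpha, beta] are only defined off the segment, so
   the values of [phi] on the segment are left unconstrained. *)
Definition represented_by (alpha beta : R)
    (mu : {measure set (measurableTypeR R) -> \bar R}) (phi : R[i] -> R[i]) :=
  mu (~` `[alpha, beta]) = 0%E /\
  forall l, off_segment alpha beta l ->
    phi l = complex_integral mu `[alpha, beta] (fun t => (t%:C - l)^-1).

Definition measure_support (mu : {measure set (measurableTypeR R) -> \bar R}) :
    set R :=
  [set x | forall U : set R, open U -> U x -> (0 < mu U)%E].

Definition denom (z : nat -> R[i]) (a1 a2 b : nat -> R) (j : nat)
    (l psi : R[i]) : R[i] :=
  (a2 j)%:C * l - (a1 j)%:C + ((b j)%:C) ^+ 2 * (l - z j) * (l - (z j)^*) * psi.

(* [phi_ j], [a1 j], [a2 j], [b j] are the functions and the coefficients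
   a_j^(1), a_j^(2), b_j produced by the step-by-step expansion of [phi]. *)
Definition step_by_step (alpha beta : R) (z : nat -> R[i])
    (phi : R[i] -> R[i]) (phi_ : nat -> R[i] -> R[i]) (a1 a2 b : nat -> R) :=
  phi_ 0%N = phi /\
  forall j : nat,
    [/\ 0 < b j,
        exists mu : probability (measurableTypeR R) R,
          represented_by alpha beta mu (phi_ j.+1)
      & forall l, off_segment alpha beta l ->
          phi_ j l = - (denom z a1 a2 b j l (phi_ j.+1 l))^-1].

(* R_{j,j+k}.  The poles of all the R_{j,n} lie in [alpha, beta], so off the
   segment no denominator below vanishes and the convention 0^-1 = 0 plays
   no role there. *)
Fixpoint tail_convergent (z : nat -> R[i]) (a1 a2 b : nat -> R) (k j : nat)
    (l : R[i]) : R[i] :=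
  if k is k'.+1 then
    - (denom z a1 a2 b j l (tail_convergent z a1 a2 b k' j.+1 l))^-1
  else - ((a2 j)%:C * l - (a1 j)%:C)^-1.

Definition convergent (z : nat -> R[i]) (a1 a2 b : nat -> R) (n : nat) :=
  tail_convergent z a1 a2 b n 0.

(* Interpolation points live on the Riemann sphere: [None] is infinity. *)
Definition local_chart (p : option R[i]) (w : R[i]) : R[i] :=
  if p is Some c then c + w else w^-1.

(* f - g vanishes at p to order at least m. *)
Definition agree_at (p : option R[i]) (m : nat) (f g : R[i] -> R[i]) :=
  exists C : R[i], \forall w \near (0 : R[i])^',
    `|f (local_chart p w) - g (local_chart p w)| <= C * `|w| ^+ m.

(* r is the ratio of two polynomials of degrees at most L and M and agrees with
   f at pts 0, ..., pts (L + M), repeated points being counted with their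
   multiplicity. *)
Definition multipoint_pade (pts : nat -> option R[i]) (f : R[i] -> R[i])
    (L M : nat) (r : R[i] -> R[i]) :=
  (exists p q : {poly R[i]},
    [/\ (size p <= L.+1)%N, (size q <= M.+1)%N, q != 0
      & forall l, q.[l] != 0 -> r l = p.[l] / q.[l]]) /\
  let s := [seq pts k | k <- iota 0 (L + M).+1] in
  forall p, p \in s -> agree_at p (count_mem p s) f r.

(* infinity, z_0, conj z_0, z_1, conj z_1, ... *)
Definition pade_points (z : nat -> R[i]) (k : nat) : option R[i] :=
  if k is k'.+1 then
    Some (if odd k' then (z k'./2)^* else z k'./2)
  else None.

Definition locally_uniformly_cvg (D : set R[i]) (f : nat -> R[i] -> R[i])
    (g : R[i] -> R[i]) :=
  forall x, D x -> exists2 U : set R[i], nbhs x U &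
    {uniform U, f @ \oo --> g}.

End Defs.

(* Main.v *)
Require Import Defs.
From mathcomp Require Import measurable_realfun ring lra.

(** Write T_k for the k-th truncation of the continued fraction (the convergent
    R_n is T_(n+1)).  The convergence is a statement about quadrature: phi and
    T_k are Cauchy transforms of two positive measures of mass at most 1 on the
    segment whose difference annihilates many rational functions with poles at
    the z_j, and 1/(t - l) is a uniform limit of such functions.

    The proof has three ingredients.

    First, T_k is the Cauchy transform of a positive discrete measure of mass at
    most 1 on [alpha, beta] ([truncation_transform]).  One step of the fraction
    sends such a transform to minus the inverse of a function p l - q + sum of
    v_k / (x_k - l), and this inverse is a diagonal entry of the resolvent of a
    real symmetric arrow matrix, so the spectral theorem yields the new nodes and
    weights ([inv_secular_function]).  Nodes off the segment get weight 0 because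
    the denominator has no zero there: off the real axis by the sign of the
    imaginary part, on it because the tails of phi dominate those of the
    truncation ([dominated_step]).  The mass stays at most 1 because comparing
    both sides of a step at infinity gives a2 = 1 + b^2 ([coef_a2]).

    Secondly, phi - T_k is the product of all (l - z_j)(l - conj z_j), j < k, with a
    function that is regular off the segment ([error_product]).  If nu is the
    difference of the two measures and zeta_j is one of z_j, conj z_j, this turns
    the integral of g(t) / (t - l) d nu, g a product of k linear fractional
    factors with poles zeta_j, into g(l) (phi l - T_k l)
    ([functional_weight]).  The factors are chosen as Blaschke factors of the
    exterior of a disc that contains the segment and leaves out l and all the
    zeta_j ([separating_disc]); such a disc exists because the zeta_j stay at
    distance delta from the real axis on one side of it.  Each factor is then
    smaller on the segment than at l by a fixed ratio q < 1, so the error is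
    O(q^k) locally uniformly off the segment ([geometric_error]).  No maximum
    principle or normal family argument enters.

    Thirdly, an [n+1/n+1] approximant p/q coincides with R_n = T_(n+1) off the
    segment ([pade_eq_truncation]).  Writing T_(n+1) = A/B, the polynomial
    p B - A q vanishes at z_0, conj z_0, ..., z_n, conj z_n with multiplicities, but
    the contact at infinity makes its degree too small, so it is 0; as A and B
    are coprime and deg B = n + 1, q is a multiple of B by a constant and has no
    zero off the segment. *)

Set Implicit Arguments.
Unset Strict Implicit.
Unset Printing Implicit Defensive.
Local Open Scope ring_scope.

(** * Lipschitz behaviour at a point and orders of vanishing *)

Section LipschitzAt.
Context {K : numFieldType}.
Implicit Types (f g : K -> K) (x y c : K).

(** A quantitative continuity at a point: it is stable under sums and products and
    needs only the norm of the field, and all the functions below have it. *)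
Definition lipschitz_at x f := exists r C : K, 0 < r /\
  forall y, `|y - x| < r -> `|f y - f x| <= C * `|y - x|.

Lemma common_radius (r s : K) : 0 < r -> 0 < s ->
  exists t : K, [/\ 0 < t, forall u, u < t -> u < r & forall u, u < t -> u < s].
Proof.
move=> r0 s0; exists (Num.min r s).
have rs : r >=< s by rewrite real_comparable ?gtr0_real.
split=> [|u|u]; first by rewrite comparable_lt_min // r0.
- by rewrite comparable_lt_min // => /andP[].
- by rewrite comparable_lt_min // => /andP[].
Qed.

Lemma lipschitz_cst_ge0 x f (r C : K) : 0 < r ->
  (forall y, `|y - x| < r -> `|f y - f x| <= C * `|y - x|) -> 0 <= C.
Proof.
move=> r0 /(_ (x + r / 2)); rewrite [x + _]addrC addrK gtr0_norm ?divr_gt0 //.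
rewrite ltr_pdivrMr // ltr_pMr // ltr1n => /(_ isT) /(le_trans (normr_ge0 _)).
by rewrite pmulr_lge0 // divr_gt0.
Qed.

Lemma lipschitz_at_cst x c : lipschitz_at x (fun=> c).
Proof. by exists 1, 0; split=> // y _; rewrite subrr normr0 mul0r. Qed.

Lemma lipschitz_at_id x : lipschitz_at x id.
Proof. by exists 1, 1; split=> // y _; rewrite mul1r. Qed.

Lemma lipschitz_atD x f g : lipschitz_at x f -> lipschitz_at x g ->
  lipschitz_at x (fun y => f y + g y).
Proof.
move=> [r [C [r0 hf]]] [s [D [s0 hg]]].
have [t [t0 tr ts]] := common_radius r0 s0.
exists t, (C + D); split=> // y yt; rewrite mulrDl.
have -> : f y + g y - (f x + g x) = (f y - f x) + (g y - g x) by ring.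
by rewrite (le_trans (ler_normD _ _)) // lerD ?hf ?hg ?tr ?ts.
Qed.

Lemma lipschitz_atM x f g : lipschitz_at x f -> lipschitz_at x g ->
  lipschitz_at x (fun y => f y * g y).
Proof.
move=> [r [C [r0 hf]]] [s [D [s0 hg]]].
have [t [t0 tr ts]] := common_radius r0 s0.
have C0 := lipschitz_cst_ge0 r0 hf; have D0 := lipschitz_cst_ge0 s0 hg.
exists t, (C * (`|g x| + D * t) + `|f x| * D); split=> // y yt.
have -> : f y * g y - f x * g x = (f y - f x) * g y + f x * (g y - g x) by ring.
have hgy := hg _ (ts _ yt); have hfy := hf _ (tr _ yt).
rewrite (le_trans (ler_normD _ _)) // !normrM mulrDl lerD //; last first.
  by rewrite -mulrA ler_wpM2l.
rewrite mulrAC ler_pM //.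
have -> : g y = g x + (g y - g x) by ring.
rewrite (le_trans (ler_normD _ _)) // lerD2l (le_trans hgy) // ler_wpM2l //.
exact: ltW.
Qed.

Lemma lipschitz_at_prod x I (r : seq I) (P : pred I) (f : I -> K -> K) :
  (forall i, lipschitz_at x (f i)) ->
  lipschitz_at x (fun y => \prod_(i <- r | P i) f i y).
Proof.
move=> hf; elim: r => [|i r IH].
  have := lipschitz_at_cst x 1; congr lipschitz_at; apply/funext => y.
  by rewrite big_nil.
have [Pi|nPi] := boolP (P i).
  have := lipschitz_atM (hf i) IH; congr lipschitz_at; apply/funext => y.
  by rewrite big_cons Pi.
by move: IH; congr lipschitz_at; apply/funext => y; rewrite big_cons (negbTE nPi).
Qed.

Lemma le0_of_small (a C r : K) : 0 < r -> 0 <= a ->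
  (forall w : K, w != 0 -> `|w| < r -> a <= C * `|w|) -> a = 0.
Proof.
move=> r0 a0 h; apply/eqP; apply: contraTT isT => a_neq0.
have {a_neq0 a0}a0 : 0 < a by rewrite lt_def a_neq0.
have Cpos : 0 < C.
  have := h (r / 2); rewrite gtr0_norm ?divr_gt0 // lt0r_neq0 ?divr_gt0 //.
  rewrite ltr_pdivrMr // ltr_pMr // ltr1n => /(_ isT isT) /(lt_le_trans a0).
  by rewrite pmulr_lgt0 // divr_gt0.
have [t [t0 tr ts]] := common_radius r0 (divr_gt0 a0 Cpos).
have w0 : 0 < t / 2 by rewrite divr_gt0.
have wt : t / 2 < t by rewrite ltr_pdivrMr // ltr_pMr // ltr1n.
have := h (t / 2); rewrite lt0r_neq0 // gtr0_norm // tr // => /(_ isT isT).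
suff : C * (t / 2) < a by move=> /lt_geF ->.
by rewrite mulrC -ltr_pdivlMr // ts.
Qed.

(** This is how removable singularities are dealt with: an identity proved away
    from a pole extends to it. *)
Lemma lipschitz_at_eq x f g (r : K) : lipschitz_at x f -> lipschitz_at x g ->
  0 < r -> (forall y, y != x -> `|y - x| < r -> f y = g y) -> f x = g x.
Proof.
move=> [s [C [s0 hf]]] [t [D [t0 hg]]] r0 fg.
have [u [u0 us ut]] := common_radius s0 t0.
have [v [v0 vu vr]] := common_radius u0 r0.
apply/eqP; rewrite -subr_eq0 -normr_eq0; apply/eqP.
apply: (@le0_of_small _ (C + D) v) => // w w0 wv.
have wE : (x + w) - x = w by ring.
have {fg}fg : f (x + w) = g (x + w).
  by apply: fg; rewrite ?wE ?vr // -subr_eq0 wE.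
have := hf (x + w); rewrite wE us ?vu // => /(_ isT) hfw.
have := hg (x + w); rewrite wE ut ?vu // => /(_ isT) hgw.
have -> : f x - g x = - (f (x + w) - f x) + (g (x + w) - g x).
  by rewrite fg; ring.
by rewrite (le_trans (ler_normD _ _)) // normrN mulrDl lerD.
Qed.

End LipschitzAt.

Section VanishingOrder.
Context {K : numFieldType}.
Implicit Types (p : {poly K}) (c : K).

Lemma lipschitz_at_horner p x : lipschitz_at x (horner p).
Proof.
elim/poly_ind: p => [|p a IH].
  have := lipschitz_at_cst x 0; congr lipschitz_at; apply/funext => y.
  by rewrite horner0.
have := lipschitz_atD (lipschitz_atM IH (lipschitz_at_id x)) (lipschitz_at_cst x a).
by congr lipschitz_at; apply/funext => y; rewrite hornerMXaddC.
Qed.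

(** After dividing out the exact power of X - c, a cofactor that still tended to 0
    at c would vanish there. *)
Lemma dvdp_of_small p c m (C r : K) : 0 < r ->
  (forall w : K, w != 0 -> `|w| < r -> `|p.[c + w]| <= C * `|w| ^+ m) ->
  ('X - c%:P) ^+ m %| p.
Proof.
move=> r0 hp; have [->|p0] := eqVneq p 0; first exact: dvdp0.
have [k [q /implyP/(_ p0) qc pE]] := multiplicity_XsubC p c.
have [mk|km] := leqP m k; first by rewrite pE dvdp_mull // dvdp_exp2l.
move: qc; rewrite rootE => /negP[].
suff : q.[c] = 0 by move=> ->.
have [s [D [s0 hq]]] := lipschitz_at_horner q c.
have [t [t0 tr ts]] := common_radius r0 s0.
have [u [u0 ut u1]] := common_radius t0 (ltr01 : 0 < 1 :> K).
apply/eqP; rewrite -normr_eq0; apply/eqP.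
have C0 : 0 <= C.
  have := hp (r / 2); rewrite gtr0_norm ?divr_gt0 // lt0r_neq0 ?divr_gt0 //.
  rewrite ltr_pdivrMr // ltr_pMr // ltr1n => /(_ isT isT) /(le_trans (normr_ge0 _)).
  by rewrite pmulr_lge0 // exprn_gt0 // divr_gt0.
apply: (@le0_of_small _ _ (C + D) u) => // w w0 wu.
have wE : (c + w) - c = w by ring.
have := hq (c + w); rewrite wE ts ?ut // => /(_ isT) hqw.
have := hp w w0 (tr _ (ut _ wu)).
rewrite pE hornerM horner_exp hornerXsubC wE normrM normrX.
rewrite -(subnK (ltnW km)) exprD mulrA ler_pM2r ?exprn_gt0 ?normr_gt0 // => hpw.
have -> : q.[c] = q.[c + w] - (q.[c + w] - q.[c]) by ring.
rewrite (le_trans (ler_normB _ _)) // mulrDl lerD // (le_trans hpw) // ler_wpM2l //.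
rewrite -(subnSK km) exprS ler_piMr // exprn_ile1 //.
by rewrite ltW // u1.
Qed.

End VanishingOrder.

Section BehaviourNearPoints.
Context {K : numFieldType}.

Lemma lipschitz_at_bounded (x : K) (f : K -> K) : lipschitz_at x f ->
  exists r M : K, [/\ 0 < r, 0 <= M & forall y, `|y - x| < r -> `|f y| <= M].
Proof.
move=> [r [C [r0 hC]]]; have C0 := lipschitz_cst_ge0 r0 hC.
exists r, (`|f x| + C * r); split=> // [|y yr].
  by rewrite addr_ge0 // mulr_ge0 // ltW.
have -> : f y = f x + (f y - f x) by ring.
rewrite (le_trans (ler_normD _ _)) // lerD2l (le_trans (hC y yr)) //.
by rewrite ler_wpM2l // ltW.
Qed.

Lemma horner_neq0_near (q : {poly K}) (c : K) : q != 0 ->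
  exists2 r : K, 0 < r & forall w, w != 0 -> `|w| < r -> q.[c + w] != 0.
Proof.
move=> q0; have [k [q' /implyP/(_ q0) qc qE]] := multiplicity_XsubC q c.
have [r [C [r0 hC]]] := lipschitz_at_horner q' c.
have C0 := lipschitz_cst_ge0 r0 hC.
have q'c : 0 < `|q'.[c]| by rewrite normr_gt0.
have C1 : 0 < C + 1 by rewrite ltr_wpDl.
have [t [t0 tr tc]] := common_radius r0 (divr_gt0 q'c C1).
exists t => // w w0 wt; have wE : (c + w) - c = w by ring.
rewrite qE hornerM horner_exp hornerXsubC wE mulf_neq0 ?expf_neq0 //.
apply/eqP => qw0; have := hC (c + w); rewrite wE qw0 sub0r normrN => /(_ (tr _ wt)).
suff : C * `|w| < `|q'.[c]| by move=> /lt_geF ->.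
rewrite (@le_lt_trans _ _ ((C + 1) * `|w|)) ?ler_wpM2r ?lerDl //.
by rewrite mulrC -ltr_pdivlMr // tc.
Qed.

(** The polynomial X^n p(1/X). *)
Definition reversal n (p : {poly K}) := \poly_(i < n.+1) p`_(n - i).

Lemma horner_reversal n (p : {poly K}) (w : K) : (size p <= n.+1)%N -> w != 0 ->
  (reversal n p).[w] = w ^+ n * p.[w^-1].
Proof.
move=> sp w0; rewrite horner_poly (horner_coef_wide _ sp) mulr_sumr.
rewrite (reindex_inj rev_ord_inj) /=; apply: eq_bigr => i _.
have il : (i <= n)%N by rewrite -ltnS.
rewrite subSS subKn // [RHS]mulrCA; congr (_ * _).
by rewrite exprVn -exprB ?unitfE.
Qed.

Lemma reversal_eq0 n (p : {poly K}) : (size p <= n.+1)%N ->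
  reversal n p = 0 -> p = 0.
Proof.
move=> sp /polyP r0; apply/polyP => i; rewrite coef0.
have [ni|ni] := ltnP n i; first by rewrite nth_default // (leq_trans sp).
by have := r0 (n - i)%N; rewrite coef_poly ltnS leq_subr subKn // coef0.
Qed.

(** Passing to reversals moves infinity to 0: the hypothesis says that the reversal
    of p vanishes at 0, and its value there is the coefficient of degree n. *)
Lemma size_le_of_infinity n (p q : {poly K}) (C r : K) : 0 < r ->
  (size p <= n.+1)%N -> (size q <= n.+1)%N -> q != 0 ->
  (forall w, w != 0 -> `|w| < r -> q.[w^-1] != 0 ->
     `|p.[w^-1] / q.[w^-1]| <= C * `|w|) -> (size p <= n)%N.
Proof.
move=> r0 sp sq q0 hC.
have rq0 : reversal n q != 0.
  by apply: contraNneq q0 => /(reversal_eq0 sq) ->.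
have [s s0 hs] := horner_neq0_near 0 rq0.
have [t [t0 tr ts]] := common_radius r0 s0.
have [u [M [u0 M0 hM]]] := lipschitz_at_bounded (lipschitz_at_horner (reversal n q) 0).
have [v [v0 vt vu]] := common_radius t0 u0.
have : ('X - 0%:P) ^+ 1 %| reversal n p.
  apply: (@dvdp_of_small _ _ 0 1 (C * M) v) => // w w0 wv; rewrite add0r expr1.
  have := hs w w0 (ts _ (vt _ wv)); rewrite add0r => qw0.
  have := hM w; rewrite subr0 => /(_ (vu _ wv)).
  move: qw0; rewrite !horner_reversal // mulf_eq0 expf_eq0 (negbTE w0) andbF /= => qw0.
  have := hC w w0 (tr _ (vt _ wv)) qw0.
  rewrite !normrM normfV ler_pdivrMr ?normr_gt0 // => h1 h2.
  apply: (@le_trans _ _ (C * `|w| * (`|w ^+ n| * `|q.[w^-1]|))).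
    by rewrite [leRHS]mulrCA ler_wpM2l.
  rewrite mulrAC ler_wpM2r // ler_wpM2l //.
  have := le_trans (normr_ge0 _) (hC w w0 (tr _ (vt _ wv)) qw0).
  by rewrite pmulr_lge0 // normr_gt0.
rewrite expr1 dvdp_XsubCl rootE horner_coef0 coef_poly /= subn0 => /eqP pn0.
apply/leq_sizeP => i; rewrite leq_eqVlt => /orP[/eqP<- //|ni].
by rewrite nth_default // (leq_trans sp).
Qed.

End BehaviourNearPoints.

(** The roots are listed with repetitions, so the hypothesis at c asks for its
    multiplicity in the list. *)
Lemma dvdp_prod_XsubC (F : fieldType) (s : seq F) (p : {poly F}) :
  (forall c, c \in s -> ('X - c%:P) ^+ count_mem c s %| p) ->
  \prod_(c <- s) ('X - c%:P) %| p.
Proof.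
elim: s p => [|a s IH] p hp; first by rewrite big_nil dvd1p.
have [->|p0] := eqVneq p 0; first exact: dvdp0.
have : 'X - a%:P %| p.
  apply: dvdp_trans (hp a (mem_head _ _)).
  by rewrite -{1}['X - a%:P]expr1 dvdp_exp2l //= eqxx.
move/dvdpP=> [q pE]; rewrite big_cons pE mulrC.
have q0 : q != 0 by apply: contraNneq p0 => q0; rewrite pE q0 mul0r.
rewrite dvdp_mul2r ?polyXsubC_eq0 //; apply: IH => c cs.
have := hp c; rewrite inE cs orbT => /(_ isT).
rewrite -!mup_geq // pE mupM ?polyXsubC_eq0 // -['X - a%:P]expr1 mup_XsubCX /=.
by case: eqP => _; rewrite ?addn1 ?addn0.
Qed.

(** * Resolvents of Hermitian and arrow matrices *)

Section Resolvent.
Context {C : numClosedFieldType}.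

(** In an orthonormal eigenbasis v i 0 becomes a sum of squared coordinates of the
    i-th basis vector over y_k - l.  No invertibility of M - l is assumed: if l is
    an eigenvalue y_k and the equation is still solvable, the k-th coordinate of
    the basis vector must be 0. *)
Lemma hermitian_resolvent n (M : 'M[C]_n) (i : 'I_n) : M \is hermsymmx ->
  exists y w : 'I_n -> C,
  [/\ forall k, 0 <= w k, \sum_k w k = 1
    & forall (l : C) (v : 'cV[C]_n), (M - l%:M) *m v = delta_mx i 0 ->
        v i 0 = \sum_k w k / (y k - l) /\ forall k, y k = l -> w k = 0].
Proof.
move=> /hermitian_normalmx /orthomx_spectralP; set P := spectralmx M.
set d := spectral_diag M => ME.
have PU : P \is unitarymx := spectral_unitarymx M.
have PV := invmx_unitary PU.
have wE k : P k i * (P k i)^* = `|P k i| ^+ 2 by rewrite normCK.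
exists (fun k => d 0 k), (fun k => `|P k i| ^+ 2); split.
- by move=> k; rewrite exprn_ge0.
- have := mulVmx (unitarymx_unit PU); rewrite PV => /matrixP/(_ i i).
  rewrite !mxE eqxx mulr1n => <-; apply: eq_bigr => k _.
  by rewrite !mxE -wE mulrC.
move=> l v Mv.
have key k : (d 0 k - l) * (P *m v) k 0 = P k i.
  have : (P *m ((M - l%:M) *m v)) k 0 = P k i.
    by rewrite Mv -colE mxE.
  rewrite mulmxBl mulmxBr ME mul_scalar_mx -scalemxAr !mulmxA mulmxV ?unitarymx_unit //.
  rewrite mul1mx -mulmxA mul_diag_mx => <-; rewrite !mxE mulrBl.
  by [].
split; last first.
  move=> k dk; have := key k; rewrite dk subrr mul0r => <-.
  by rewrite normr0 expr0n.
have -> : v i 0 = (invmx P *m (P *m v)) i 0.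
  by rewrite mulmxA mulVmx ?unitarymx_unit // mul1mx.
rewrite PV mxE; apply: eq_bigr => k _; rewrite -wE.
rewrite (_ : map_mx _ _ i k = (P k i)^* ); last by rewrite !mxE.
have [dl|dl] := eqVneq (d 0 k - l) 0.
  have := key k; rewrite dl mul0r => <-; by rewrite rmorph0 !mul0r.
by set c := (P k i)^*; rewrite -(key k); field.
Qed.

(** The function D is the Schur complement of the lower right block in M - l, where
    M is the real symmetric arrow matrix with corner q, border u and diagonal x;
    hence its inverse is the corner entry of the resolvent of M.  The nodes y_k are
    the eigenvalues of M. *)
Lemma inv_secular_function n (x u : 'I_n -> C) (q : C) :
  q \is Num.real -> (forall k, x k \is Num.real) -> (forall k, u k \is Num.real) ->
  exists y w : 'I_n.+1 -> C,
  [/\ forall k, 0 <= w k, \sum_k w k = 1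
    & forall l : C, (forall k, x k != l) ->
        let D := q - l - \sum_k u k ^+ 2 / (x k - l) in D != 0 ->
        D^-1 = \sum_k w k / (y k - l) /\ forall k, y k = l -> w k = 0].
Proof.
move=> qR xR uR.
pose M : 'M[C]_(1 + n) := block_mx q%:M (\row_k u k) (\col_k u k) (diag_mx (\row_k x k)).
have cR a : a \is Num.real -> (a : C)^* = a by move/CrealP.
have Mh : M \is hermsymmx.
  apply/is_hermitianmxP; rewrite expr0 scale1r /M tr_block_mx map_block_mx.
  rewrite tr_scalar_mx tr_diag_mx map_scalar_mx map_diag_mx /= cR //.
  by congr block_mx; rewrite ?tr_col ?tr_row; [| |congr diag_mx];
    apply/matrixP => a b; rewrite !mxE cR.
have [y [w [w0 w1 hw]]] := hermitian_resolvent (lshift n 0) Mh.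
exists y, w; split=> // l xl D D0.
(* The first column of the inverse of M - l, by block elimination. *)
pose v : 'cV[C]_(1 + n) := col_mx (D^-1)%:M (\col_k (- (u k / (x k - l)) / D)).
have xl0 k : x k - l != 0 by rewrite subr_eq0.
have Mv : (M - l%:M) *m v = delta_mx (lshift n 0) 0.
  rewrite scalar_mx_block /M opp_block_mx add_block_mx !oppr0 !addr0 mul_block_col.
  have -> : delta_mx (lshift n 0) 0 = col_mx 1%:M 0 :> 'cV[C]_(1 + n).
    apply/matrixP => a b; rewrite !mxE ord1 eqxx andbT.
    case: split_ordP => j ->; rewrite !mxE.
      by rewrite !ord1 eqxx.
    by rewrite eq_rlshift.
  congr col_mx; apply/matrixP => a b; rewrite ?ord1 !mxE.
    rewrite big_ord1 !mxE eqxx !mulr1n -[RHS](mulfV D0) [in RHS]/D !mulrBl.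
    rewrite mulr_suml; congr (_ + _); rewrite -sumrN; apply: eq_bigr => k _.
    by rewrite !mxE -/D; field; rewrite D0 xl0.
  rewrite big_ord1 !mxE eqxx mulr1n (bigD1 a) //= big1 => [|k ka]; last first.
    by rewrite !mxE eq_sym (negbTE ka) /= mulr0n subrr mul0r.
  by rewrite !mxE eqxx !mulr1n; field; rewrite D0 xl0.
have [<- hy] := hw l v Mv; split=> //.
by rewrite col_mxEu mxE eqxx mulr1n.
Qed.

(** The imaginary parts of -l and of all the -u_k^2 / (x_k - l) have the same
    sign. *)
Lemma secular_function_neq0 n (x u : 'I_n -> C) (q l : C) :
  q \is Num.real -> (forall k, x k \is Num.real) -> (forall k, u k \is Num.real) ->
  l \isn't Num.real -> q - l - \sum_k u k ^+ 2 / (x k - l) != 0.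
Proof.
move=> qR xR uR lnR; have Iml : 'Im l != 0 by apply: contraNneq lnR => /Creal_ImP.
have xl k : x k - l != 0.
  by rewrite subr_eq0; apply: contraNneq lnR => <-.
apply/eqP => /(congr1 (@Im C)); rewrite !raddfB raddf0 /= raddf_sum /=.
have -> : \sum_k 'Im (u k ^+ 2 / (x k - l)) =
    'Im l * \sum_k u k ^+ 2 / `|x k - l| ^+ 2.
  rewrite mulr_sumr; apply: eq_bigr => k _.
  rewrite ImMl ?rpredX // ImV raddfB /= (Creal_ImP _ (xR k)) sub0r opprK.
  by rewrite mulrCA.
rewrite (Creal_ImP _ qR) sub0r -opprD -{1}['Im l]mulr1 -mulrDr => /eqP.
rewrite oppr_eq0 mulf_eq0 (negbTE Iml) /= => /eqP; apply/eqP/lt0r_neq0.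
by rewrite ltr_pwDl // sumr_ge0 // => k _; rewrite divr_ge0 ?real_exprn_even_ge0.
Qed.

End Resolvent.

Local Open Scope classical_set_scope.
Local Open Scope ring_scope.
Local Open Scope complex_scope.

(** * Bounded functionals and their Cauchy transforms *)

Section Functionals.
Context {R : realType}.
Variables (alpha beta : R).
Hypothesis hab : alpha < beta.
Implicit Types (f g : R -> R[i]) (l : R[i]).

(** The densities against which all functionals below act; the class is an algebra
    containing the Cauchy kernels of the points off the segment. *)
Definition bounded_measurable f :=
  [/\ measurable_fun (`[alpha, beta] : set (measurableTypeR R)) (fun t => complex.Re (f t)),
      measurable_fun (`[alpha, beta] : set (measurableTypeR R)) (fun t => complex.Im (f t))
    & exists M : R[i], forall t, alpha <= t <= beta -> `|f t| <= M].

(** The common abstraction of integration against a probability measure, of a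
    discrete quadrature formula, and of the difference of the two, which is not
    positive: only linearity and a uniform bound are kept. *)
Definition bounded_functional (L : (R -> R[i]) -> R[i]) (C : R[i]) :=
  (forall a f g, bounded_measurable f -> bounded_measurable g ->
     L (fun t => a * f t + g t) = a * L f + L g) /\
  (forall f M, bounded_measurable f ->
     (forall t, alpha <= t <= beta -> `|f t| <= M) -> `|L f| <= C * M).

Lemma bounded_measurable_cst c : bounded_measurable (fun=> c).
Proof. by split; [exact: measurable_cst|exact: measurable_cst|exists `|c|]. Qed.

Lemma bounded_measurableD f g : bounded_measurable f -> bounded_measurable g ->
  bounded_measurable (fun t => f t + g t).
Proof.
move=> [fr fi [M fM]] [gr gi [N gN]]; split.
- have -> : (fun t => complex.Re (f t + g t)) =
     (fun t => complex.Re (f t)) \+ (fun t => complex.Re (g t)).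
    by apply/funext => t /=; case: (f t) (g t) => ? ? [].
  exact: measurable_funD.
- have -> : (fun t => complex.Im (f t + g t)) =
     (fun t => complex.Im (f t)) \+ (fun t => complex.Im (g t)).
    by apply/funext => t /=; case: (f t) (g t) => ? ? [].
  exact: measurable_funD.
- exists (M + N) => t tab; rewrite (le_trans (ler_normD _ _)) //.
  by rewrite lerD ?fM ?gN.
Qed.

Lemma bounded_measurableM f g : bounded_measurable f -> bounded_measurable g ->
  bounded_measurable (fun t => f t * g t).
Proof.
move=> [fr fi [M fM]] [gr gi [N gN]]; split.
- have -> : (fun t => complex.Re (f t * g t)) =
     ((fun t => complex.Re (f t)) \* (fun t => complex.Re (g t))) \-
     ((fun t => complex.Im (f t)) \* (fun t => complex.Im (g t))).
    by apply/funext => t /=; case: (f t) (g t) => ? ? [].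
  by apply: measurable_funB; exact: measurable_funM.
- have -> : (fun t => complex.Im (f t * g t)) =
     ((fun t => complex.Re (f t)) \* (fun t => complex.Im (g t))) \+
     ((fun t => complex.Im (f t)) \* (fun t => complex.Re (g t))).
    by apply/funext => t /=; case: (f t) (g t) => ? ? [].
  by apply: measurable_funD; exact: measurable_funM.
- by exists (M * N) => t tab; rewrite normrM ler_pM ?fM ?gN.
Qed.

Lemma bounded_measurable_prod I (r : seq I) (P : pred I) (f : I -> R -> R[i]) :
  (forall i, bounded_measurable (f i)) ->
  bounded_measurable (fun t => \prod_(i <- r | P i) f i t).
Proof.
move=> hf; elim: r => [|i r IH].
  have := bounded_measurable_cst 1; congr bounded_measurable; apply/funext => t.
  by rewrite big_nil.
have [Pi|nPi] := boolP (P i).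
  have := bounded_measurableM (hf i) IH; congr bounded_measurable; apply/funext => t.
  by rewrite big_cons Pi.
by move: IH; congr bounded_measurable; apply/funext => t; rewrite big_cons (negbTE nPi).
Qed.

Lemma off_segmentP l :
  off_segment alpha beta l <-> forall t, alpha <= t <= beta -> t%:C != l.
Proof.
split=> [h t tab|h [t] /=].
  apply/eqP => tl; apply: h; exists t => //=; by rewrite in_itv.
by rewrite in_itv /= => /h /eqP tl /esym/esym.
Qed.

(** Off the segment, l keeps a positive distance to it: either its imaginary
    part or one of the gaps to the endpoints bounds the distance below. *)
Lemma off_segment_dist l : off_segment alpha beta l ->
  exists2 d : R[i], 0 < d & forall t, alpha <= t <= beta -> d <= `|t%:C - l|.
Proof.
case: l => x y /off_segmentP h.
have [y0|y0] := eqVneq y 0; last first.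
  exists `|y|%:C => [|t _]; first by rewrite ltcR normr_gt0.
  rewrite normc_def lecR -sqrtr_sqr ler_sqrt /= ?addr_ge0 ?sqr_ge0 //.
  by rewrite add0r sqrrN lerDr sqr_ge0.
have xout : x < alpha \/ beta < x.
  have [xa|ax] := ltP x alpha; first by left.
  have [bx|xb] := ltP beta x; first by right.
  by have := h x; rewrite ax xb => /(_ isT); rewrite y0 eqxx.
have nE t : `|t%:C - (x +i* y)| = `|t - x|%:C.
  by rewrite normc_def /= y0 subr0 expr0n addr0 sqrtr_sqr.
case: xout => xout.
  exists (alpha - x)%:C => [|t /andP[at_ _]]; first by rewrite ltcR subr_gt0.
  rewrite nE lecR ger0_norm; lra.
exists (x - beta)%:C => [|t /andP[_ tb]]; first by rewrite ltcR subr_gt0.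
rewrite nE lecR ler0_norm; lra.
Qed.

Lemma continuous_measurable_segment (h : R -> R) :
  (forall t, alpha <= t <= beta -> {for t, continuous h}) ->
  measurable_fun (`[alpha, beta] : set (measurableTypeR R)) h.
Proof.
move=> hc; apply: subspace_continuous_measurable_fun; first exact: measurable_itv.
apply: continuous_in_subspaceT => t; rewrite inE /= in_itv /=; exact: hc.
Qed.

Lemma bounded_measurable_cauchy l : off_segment alpha beta l ->
  bounded_measurable (fun t => (t%:C - l)^-1).
Proof.
move=> hl; have [d d0 hd] := off_segment_dist hl.
case: l hl hd => x y hl hd.
have E t : (t%:C - (x +i* y))^-1 =
    ((t - x) / ((t - x) ^+ 2 + y ^+ 2)) +i* (y / ((t - x) ^+ 2 + y ^+ 2)).
  by rewrite /GRing.inv /= /invc /= add0r sqrrN mulNr opprK.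
have den t : alpha <= t <= beta -> (t - x) ^+ 2 + y ^+ 2 != 0.
  move=> tab; apply/eqP => e0; move/off_segmentP/(_ t tab)/eqP: hl; apply.
  have : (t - x) ^+ 2 == 0 /\ y ^+ 2 == 0.
    by move/eqP: e0; rewrite paddr_eq0 ?sqr_ge0 // => /andP[].
  by rewrite !sqrf_eq0 subr_eq0 => -[/eqP-> /eqP->].
have cden t : {for t, continuous (fun t : R => (t - x) ^+ 2 + y ^+ 2)}.
  apply: cvgD; last exact: cvg_cst.
  by apply: cvgM; apply: cvgB; [exact: cvg_id|exact: cvg_cst| exact: cvg_id|exact: cvg_cst].
split.
- rewrite [X in measurable_fun _ X](_ : _ = fun t => (t - x) / ((t - x) ^+ 2 + y ^+ 2)).
  apply: continuous_measurable_segment => t tab; apply: cvgM; first by apply: cvgB; [exact: cvg_id|exact: cvg_cst].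
  by apply: cvgV; [exact: den|exact: cden].
  by apply/funext => t; rewrite E.
- rewrite [X in measurable_fun _ X](_ : _ = fun t => y / ((t - x) ^+ 2 + y ^+ 2)).
  apply: continuous_measurable_segment => t tab; apply: cvgM; first exact: cvg_cst.
  by apply: cvgV; [exact: den|exact: cden].
  by apply/funext => t; rewrite E.
- exists d^-1 => t tab; rewrite normfV lef_pV2 ?posrE ?hd //.
  exact: lt_le_trans d0 (hd t tab).
Qed.

Lemma bounded_functional_sub L1 L2 C1 C2 :
  bounded_functional L1 C1 -> bounded_functional L2 C2 ->
  bounded_functional (fun f => L1 f - L2 f) (C1 + C2).
Proof.
move=> [lin1 bd1] [lin2 bd2]; split=> [a f g hf hg|f M hf fM].
  by rewrite lin1 // lin2 //; ring.
by rewrite (le_trans (ler_normB _ _)) // mulrDl lerD ?bd1 ?bd2.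
Qed.

Lemma bounded_functional_sum n (w : 'I_n -> R[i]) (x : 'I_n -> R) :
  (forall k, 0 <= w k) -> \sum_k w k <= 1 -> (forall k, alpha <= x k <= beta) ->
  bounded_functional (fun f => \sum_k w k * f (x k)) 1.
Proof.
move=> w0 w1 xab; split=> [a f g _ _|f M _ fM].
  by rewrite mulr_sumr -big_split /=; apply: eq_bigr => k _; ring.
have M0 : 0 <= M by apply: le_trans (fM alpha _) => //; rewrite lexx ltW.
rewrite (le_trans (ler_norm_sum _ _ _)) //.
apply: (@le_trans _ _ (\sum_k w k * M)).
  by apply: ler_sum => k _; rewrite normrM ger0_norm // ler_wpM2l // fM.
by rewrite -mulr_suml ler_wpM2r.
Qed.

Lemma integrable_part (mu : probability (measurableTypeR R) R) (h : R -> R) (m : R) :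
  measurable_fun (`[alpha, beta] : set (measurableTypeR R)) h ->
  (forall t, alpha <= t <= beta -> `|h t| <= m) ->
  mu.-integrable `[alpha, beta] (EFin \o h) /\
  `|\int[mu]_(t in `[alpha, beta]) h t| <= m.
Proof.
move=> mh hm; have mI : measurable (`[alpha, beta] : set (measurableTypeR R)).
  exact: measurable_itv.
have fin : (mu `[alpha, beta]%classic < +oo)%E.
  by rewrite (le_lt_trans (probability_le1 _ _)) ?ltry.
have ih : mu.-integrable `[alpha, beta] (EFin \o h).
  apply: measurable_bounded_integrable => //.
  exists m; split; first exact: num_real.
  move=> u mu_ t /=; rewrite in_itv /= => /hm /le_trans; apply; exact: ltW.
have m0 : 0 <= m by apply: le_trans (hm alpha _) => //; rewrite lexx ltW.
split=> //; rewrite (le_trans (le_normr_Rintegral _ _)) //.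
apply: (@le_trans _ _ (\int[mu]_(t in `[alpha, beta]) m)).
  apply: le_Rintegral => //.
  - exact: integrable_norm.
  - apply: measurable_bounded_integrable => //.
    exists m; split; first exact: num_real.
    by move=> u mu_ t _ /=; rewrite ger0_norm // ltW.
rewrite Rintegral_cst // ler_piMr // -lee_fin fineK ?probability_le1 //.
by rewrite ge0_fin_numE.
Qed.

(** The constant is 2 rather than 1 because real and imaginary parts are estimated
    separately. *)
Lemma bounded_functional_integral (mu : probability (measurableTypeR R) R) :
  bounded_functional (complex_integral mu `[alpha, beta]) 2.
Proof.
have mI : measurable (`[alpha, beta] : set (measurableTypeR R)).
  exact: measurable_itv.
have parts f (M : R[i]) : bounded_measurable f ->
    (forall t, alpha <= t <= beta -> `|f t| <= M) ->
    [/\ M = (complex.Re M)%:C,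
       mu.-integrable `[alpha, beta] (EFin \o (fun t => complex.Re (f t))),
       mu.-integrable `[alpha, beta] (EFin \o (fun t => complex.Im (f t))),
       `|\int[mu]_(t in `[alpha, beta]) complex.Re (f t)| <= complex.Re M &
       `|\int[mu]_(t in `[alpha, beta]) complex.Im (f t)| <= complex.Re M].
  move=> [fr fi _] fM.
  have M0 : 0 <= M by apply: le_trans (fM alpha _) => //; rewrite lexx ltW.
  have MR : M = (complex.Re M)%:C by rewrite RRe_real // ger0_real.
  have bnd t : alpha <= t <= beta ->
      `|complex.Re (f t)| <= complex.Re M /\ `|complex.Im (f t)| <= complex.Re M.
    move=> /fM; rewrite {1}MR normc_def lecR => h.
    split; apply: le_trans h; rewrite -sqrtr_sqr ler_sqrt ?addr_ge0 ?sqr_ge0 //.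
      by rewrite lerDl sqr_ge0.
    by rewrite lerDr sqr_ge0.
  have [ir br] := integrable_part mu fr (fun t tab => (bnd t tab).1).
  by have [ii bi] := integrable_part mu fi (fun t tab => (bnd t tab).2).
split=> [a f g hf hg|f M hf fM]; last first.
  have [MR _ _ br bi] := parts f M hf fM.
  rewrite /complex_integral [X in `|X|]complexE /= (le_trans (ler_normD _ _)) //.
  rewrite normrM MR mulr_natl mulr2n; apply: lerD.
    by rewrite normc_def /= expr0n addr0 sqrtr_sqr lecR.
  have -> : `|'i%C| = 1 :> R[i] by rewrite normc_def /= expr0n expr1n add0r sqrtr1.
  by rewrite mul1r normc_def /= expr0n addr0 sqrtr_sqr lecR.
have [_ _ [M fM]] := hf; have [_ fr fi _ _] := parts f M hf fM.
have [_ _ [N gN]] := hg; have [_ gr gi _ _] := parts g N hg gN.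
case: a => a b; rewrite /complex_integral.
have intZ c h : mu.-integrable `[alpha, beta] (EFin \o h) ->
    mu.-integrable `[alpha, beta] (EFin \o (fun t => c * h t)).
  by move=> ih; have := integrableZl mI c ih.
have intD h1 h2 : mu.-integrable `[alpha, beta] (EFin \o h1) ->
    mu.-integrable `[alpha, beta] (EFin \o h2) ->
    mu.-integrable `[alpha, beta] (EFin \o (fun t => h1 t + h2 t)).
  by move=> i1 i2; have := integrableD mI i1 i2.
have rE : (\int[mu]_(t in `[alpha, beta]) complex.Re ((a +i* b) * f t + g t)) =
  \int[mu]_(t in `[alpha, beta])
    ((a * complex.Re (f t) + (- b) * complex.Im (f t)) + complex.Re (g t)).
  by apply: eq_Rintegral => t _; case: (f t) (g t) => ? ? [? ?] /=; rewrite mulNr.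
have iE : (\int[mu]_(t in `[alpha, beta]) complex.Im ((a +i* b) * f t + g t)) =
  \int[mu]_(t in `[alpha, beta])
    ((a * complex.Im (f t) + b * complex.Re (f t)) + complex.Im (g t)).
  by apply: eq_Rintegral => t _; case: (f t) (g t) => ? ? [? ?] /=; ring.
have afr := intZ a _ fr; have bfi := intZ (- b) _ fi.
have afi := intZ a _ fi; have bfr := intZ b _ fr.
rewrite rE iE (RintegralD mI (intD _ _ afr bfi) gr) (RintegralD mI (intD _ _ afi bfr) gi).
rewrite (RintegralD mI afr bfi) (RintegralD mI afi bfr).
rewrite (RintegralZl a mI fr) (RintegralZl (- b) mI fi).
rewrite (RintegralZl a mI fi) (RintegralZl b mI fr).
by simpc; congr (_ +i* _); ring.
Qed.

Lemma off_segment_near l : off_segment alpha beta l ->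
  exists2 d : R[i], 0 < d & forall k, `|k - l| < d ->
    off_segment alpha beta k /\ forall t, alpha <= t <= beta -> d <= `|t%:C - k|.
Proof.
move=> /off_segment_dist[d d0 hd]; exists (d / 2); first by rewrite divr_gt0.
move=> k kl; have far t : alpha <= t <= beta -> d / 2 <= `|t%:C - k|.
  move=> /hd dt; have : d <= `|t%:C - k| + d / 2.
    rewrite (le_trans dt) // (le_trans (ler_distD k _ _)) // lerD2l.
    exact: ltW.
  by rewrite -lerBlDr (_ : d - d / 2 = d / 2) //; field.
split=> //; apply/off_segmentP => t tab; rewrite -subr_eq0 -normr_gt0.
by rewrite (lt_le_trans _ (far t tab)) // divr_gt0.
Qed.

Section Linearity.
Variables (L : (R -> R[i]) -> R[i]) (C : R[i]).
Hypothesis hL : bounded_functional L C.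

Lemma functionalB f g : bounded_measurable f -> bounded_measurable g ->
  L (fun t => f t - g t) = L f - L g.
Proof.
move=> hf hg; have := hL.1 (-1) g f hg hf.
by rewrite mulN1r addrC => <-; congr L; apply/funext => t; ring.
Qed.

Lemma functional_eq f g : bounded_measurable f -> bounded_measurable g ->
  (forall t, alpha <= t <= beta -> f t = g t) -> L f = L g.
Proof.
move=> hf hg fg; apply/eqP; rewrite -subr_eq0 -functionalB // -normr_le0.
have hN : bounded_measurable (fun t => f t - g t).
  have := bounded_measurableD hf (bounded_measurableM (bounded_measurable_cst (-1)) hg).
  by congr bounded_measurable; apply/funext => t; rewrite mulN1r.
by rewrite (le_trans (hL.2 _ 0 hN _)) ?mulr0 // => t tab; rewrite fg // subrr normr0.
Qed.

Lemma functionalZ a f : bounded_measurable f -> L (fun t => a * f t) = a * L f.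
Proof.
move=> hf; have h0 := bounded_measurable_cst 0.
have := hL.1 a f _ hf h0; have L0 : L (fun=> 0) = 0.
  apply/eqP; rewrite -normr_le0 (le_trans (hL.2 _ 0 h0 _)) ?mulr0 // => t _.
  by rewrite normr0.
by rewrite L0 addr0 => <-; congr L; apply/funext => t; rewrite addr0.
Qed.

Lemma bounded_measurable_div f l : bounded_measurable f -> off_segment alpha beta l ->
  bounded_measurable (fun t => f t / (t%:C - l)).
Proof. by move=> hf hl; apply: bounded_measurableM hf (bounded_measurable_cauchy hl). Qed.

(** The resolvent identity, integrated against a density f. *)
Lemma functional_resolvent f k l : bounded_measurable f ->
  off_segment alpha beta k -> off_segment alpha beta l ->
  L (fun t => f t / (t%:C - k)) - L (fun t => f t / (t%:C - l)) =
  (k - l) * L (fun t => f t / (t%:C - k) / (t%:C - l)).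
Proof.
move=> hf hk hl; have fk := bounded_measurable_div hf hk.
have fl := bounded_measurable_div hf hl; have fkl := bounded_measurable_div fk hl.
rewrite -functionalB // -functionalZ //; apply: functional_eq.
- have := bounded_measurableD fk (bounded_measurableM (bounded_measurable_cst (-1)) fl).
  by congr bounded_measurable; apply/funext => t; rewrite mulN1r.
- exact: bounded_measurableM (bounded_measurable_cst _) fkl.
move=> t tab; have := (off_segmentP k).1 hk t tab; have := (off_segmentP l).1 hl t tab.
rewrite -subr_eq0 => tl; rewrite -subr_eq0 => tk; field; exact/andP.
Qed.

(** By the resolvent identity the increment is (k - l) times the integral of a
    kernel that stays bounded when k is near l. *)
Lemma lipschitz_at_functional f l : 0 <= C ->
  bounded_measurable f -> off_segment alpha beta l ->
  lipschitz_at l (fun k => L (fun t => f t / (t%:C - k))).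
Proof.
move=> C0 hf hl; have [d d0 hd] := off_segment_near hl.
have [_ _ [M fM]] := hf.
exists d, (C * (M / d / d)); split=> // k kl; have [hk kd] := hd k kl.
have ld : forall t, alpha <= t <= beta -> d <= `|t%:C - l|.
  by apply: (hd l _).2; rewrite subrr normr0.
rewrite functional_resolvent // normrM mulrC ler_wpM2r //.
apply: hL.2 => [|t tab].
  by apply: bounded_measurable_div hl; exact: bounded_measurable_div.
have inv_le e : d <= e -> e^-1 <= d^-1.
  by move=> de; rewrite lef_pV2 ?posrE // (lt_le_trans d0 de).
rewrite !normrM !normfV.
by do 2?[apply: ler_pM; rewrite ?mulr_ge0 ?invr_ge0 //]; rewrite ?fM ?inv_le ?kd ?ld.
Qed.

End Linearity.

End Functionals.

(** * Cauchy transforms of probability measures *)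

Section Markov.
Context {R : realType}.
Variables (alpha beta : R).
Hypothesis hab : alpha < beta.
Implicit Types (l : R[i]) (f : R[i] -> R[i]).

Lemma probability_segment (mu : probability (measurableTypeR R) R) :
  mu (~` `[alpha, beta]) = 0%E -> mu `[alpha, beta]%classic = 1%E.
Proof.
move=> mu0; have mI : measurable (`[alpha, beta] : set (measurableTypeR R)).
  exact: measurable_itv.
rewrite -[X in mu X]setCK probability_setC; last exact: measurableC.
by rewrite mu0 sube0.
Qed.

Lemma Rintegral_segment_cst (mu : probability (measurableTypeR R) R) (c : R) :
  mu (~` `[alpha, beta]) = 0%E -> (\int[mu]_(t in `[alpha, beta]) c) = c.
Proof.
move=> mu0; have mI : measurable (`[alpha, beta] : set (measurableTypeR R)).
  exact: measurable_itv.
have m1 := probability_segment mu0; rewrite Rintegral_cst //.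
by rewrite [X in fine X]m1 mulr1.
Qed.

Lemma complex_integral1 (mu : probability (measurableTypeR R) R) :
  mu (~` `[alpha, beta]) = 0%E -> complex_integral mu `[alpha, beta] (fun=> 1) = 1.
Proof. by move=> mu0; rewrite /complex_integral /= !Rintegral_segment_cst. Qed.

Lemma segment_bound : exists2 B : R[i], 0 < B &
  forall t : R, alpha <= t <= beta -> `|t%:C| <= B.
Proof.
exists (`|alpha| + `|beta| + 1)%:C.
  by rewrite ltcR ltr_wpDl // addr_ge0.
move=> t /andP[at_ tb]; rewrite normc_def /= expr0n addr0 sqrtr_sqr lecR.
have := ler_norm (- alpha); have := ler_norm beta; rewrite normrN.
have := normr_ge0 alpha; have := normr_ge0 beta.
by rewrite ler_norml; lra.
Qed.

Lemma bounded_measurable_real : bounded_measurable alpha beta (fun t => t%:C).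
Proof.
split; first exact: measurable_id.
  exact: measurable_cst.
by have [B _ hB] := segment_bound; exists B.
Qed.

Lemma off_segment_far B l : (forall t : R, alpha <= t <= beta -> `|t%:C| <= B) ->
  B < `|l| -> off_segment alpha beta l.
Proof.
move=> hB Bl; apply/off_segmentP => t tab; apply: contraTneq Bl => <-.
by rewrite -real_leNgt ?ger0_real ?(le_trans (normr_ge0 _) (hB t tab)) ?hB.
Qed.

(** The Cauchy transform of a probability measure is -1/l at infinity. *)
Lemma markov_at_infinity (mu : probability (measurableTypeR R) R) f :
  represented_by alpha beta mu f ->
  exists r C : R[i], [/\ 0 < r, 0 <= C & forall l, r < `|l| ->
    off_segment alpha beta l /\ `|l * f l + 1| <= C / `|l|].
Proof.
move=> [mu0 hf]; have [B B0 hB] := segment_bound.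
have hL := bounded_functional_integral hab mu.
exists (2 * B), (4 * B); split=> [||l Bl]; [exact: mulr_gt0|by rewrite mulr_ge0 // ltW|].
have l0 : 0 < `|l| by rewrite (lt_trans _ Bl) // mulr_gt0.
have hl : off_segment alpha beta l.
  by apply: (off_segment_far hB); rewrite (lt_trans _ Bl) // ltr_pMl // ltr1n.
split=> //; have hc := bounded_measurable_cauchy hl.
rewrite hf //.
have -> : l * complex_integral mu `[alpha, beta] (fun t => (t%:C - l)^-1) + 1 =
    complex_integral mu `[alpha, beta] (fun t => l * (t%:C - l)^-1 + 1).
  rewrite hL.1 //; last exact: bounded_measurable_cst.
  by congr (_ + _); rewrite complex_integral1.
have E (t : R) : alpha <= t <= beta -> l / (t%:C - l) + 1 = t%:C / (t%:C - l).
  move=> tab; have /off_segmentP/(_ t tab) := hl; rewrite -subr_eq0 => tl; field.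
  exact: tl.
have h1 : bounded_measurable alpha beta (fun t => l * (t%:C - l)^-1 + 1).
  apply: bounded_measurableD; last exact: bounded_measurable_cst.
  by apply: bounded_measurableM hc; exact: bounded_measurable_cst.
have -> : 4 * B / `|l| = 2 * (B * 2 / `|l|) by field; rewrite gt_eqF.
apply: hL.2 => // t tab; rewrite E // normrM normfV.
have tl : `|l| / 2 <= `|t%:C - l|.
  have : `|l| <= `|t%:C - l| + `|t%:C|.
    by rewrite distrC -{1}[l](subrK t%:C) ler_normD.
  move=> h; have : `|l| <= `|t%:C - l| + `|l| / 2.
    rewrite (le_trans h) // lerD2l (le_trans (hB t tab)) //.
    by rewrite ler_pdivlMr // mulrC ltW.
  by rewrite -lerBlDr (_ : `|l| - `|l| / 2 = `|l| / 2) //; field.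
have l20 : 0 < `|l| / 2 by rewrite divr_gt0.
rewrite -mulrA ler_pM ?invr_ge0 ?hB //.
by rewrite (_ : 2 / `|l| = (`|l| / 2)^-1) ?lef_pV2 ?posrE ?(lt_le_trans l20 tl) // invf_div.
Qed.

(** On the real axis the kernel 1/(t - x) is real of constant sign, and bounded away
    from 0 by its value at the farther endpoint. *)
Lemma markov_real (mu : probability (measurableTypeR R) R) f (x : R) :
  represented_by alpha beta mu f -> off_segment alpha beta x%:C ->
  (beta < x -> f x%:C < 0) /\ (x < alpha -> 0 < f x%:C).
Proof.
move=> [mu0 hf] hx; have mI : measurable (`[alpha, beta] : set (measurableTypeR R)).
  exact: measurable_itv.
have [hr hi [M hM]] := bounded_measurable_cauchy hx.
have cE t : (t%:C - x%:C)^-1 = ((t - x)^-1)%:C :> R[i].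
  by rewrite -rmorphB -fmorphV.
rewrite hf // /complex_integral.
have -> : (\int[mu]_(t in `[alpha, beta]) complex.Im ((t%:C - x%:C)^-1)) = 0.
  rewrite -[RHS](Rintegral_segment_cst 0 mu0).
  by apply: eq_Rintegral => t _; rewrite cE.
have -> : (\int[mu]_(t in `[alpha, beta]) complex.Re ((t%:C - x%:C)^-1)) =
    \int[mu]_(t in `[alpha, beta]) ((t - x)^-1).
  by apply: eq_Rintegral => t _; rewrite cE.
have hr' : measurable_fun (`[alpha, beta] : set (measurableTypeR R)) (fun t => (t - x)^-1).
  by move: hr; congr measurable_fun; apply/funext => t; rewrite cE.
have [|ir _] := @integrable_part _ _ _ hab mu _ (complex.Re M) hr'.
  move=> t tab; have := hM t tab; rewrite cE normc_def /= expr0n addr0 sqrtr_sqr.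
  by rewrite lecE /= => /andP[].
have ic c : mu.-integrable `[alpha, beta] (EFin \o (fun=> c)).
  by have [|//|] := @integrable_part _ _ _ hab mu (fun=> c) `|c|.
have int_cst c : (\int[mu]_(t in `[alpha, beta]) c) = c.
  exact: Rintegral_segment_cst.
split=> hx'; rewrite ltcE /= eqxx /=.
  apply: (@le_lt_trans _ _ (\int[mu]_(t in `[alpha, beta]) (alpha - x)^-1)).
    apply: le_Rintegral => // t /=; rewrite in_itv /= => /andP[at_ tb].
    rewrite -[leLHS]opprK -[leRHS]opprK lerN2 -!invrN !opprB lef_pV2 ?posrE; lra.
  by rewrite int_cst invr_lt0 subr_lt0 (lt_trans hab).
apply: (@lt_le_trans _ _ (\int[mu]_(t in `[alpha, beta]) (beta - x)^-1)).
  by rewrite int_cst invr_gt0 subr_gt0 (lt_trans hx').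
apply: le_Rintegral => // t /=; rewrite in_itv /= => /andP[at_ tb].
rewrite lef_pV2 ?posrE; lra.
Qed.

(** Off the real axis the imaginary part of the transform has the sign of the
    imaginary part of l, so a Cauchy transform never vanishes off the segment. *)
Lemma markov_neq0 (mu : probability (measurableTypeR R) R) f l :
  represented_by alpha beta mu f -> off_segment alpha beta l -> f l != 0.
Proof.
move=> hf hl; case: (hf) => mu0 fE.
have mI : measurable (`[alpha, beta] : set (measurableTypeR R)).
  exact: measurable_itv.
have [hr hi [M hM]] := bounded_measurable_cauchy hl.
have [|ii _] := @integrable_part _ _ _ hab mu _ (complex.Re M) hi.
  move=> t tab; have := hM t tab; rewrite normc_def lecE /= => /andP[_].
  apply: le_trans; rewrite -sqrtr_sqr ler_sqrt ?addr_ge0 ?sqr_ge0 //.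
  by rewrite lerDr sqr_ge0.
have ic c : mu.-integrable `[alpha, beta] (EFin \o (fun=> c)).
  by have [|//|] := @integrable_part _ _ _ hab mu (fun=> c) `|c|.
move: hl hi ii; case: l {hr hM} => x y hl hi ii.
have [y0|y0] := eqVneq y 0.
  move: hl; rewrite y0 complexr0 => hl.
  have /off_segmentP h := hl; have [xa|ax] := ltP x alpha.
    by rewrite gt_eqF // (markov_real hf hl).2.
  have [bx|xb] := ltP beta x; first by rewrite lt_eqF // (markov_real hf hl).1.
  by have := h x; rewrite ax xb => /(_ isT); rewrite eqxx.
pose N := (alpha - x) ^+ 2 + (beta - x) ^+ 2 + y ^+ 2.
have y2 : 0 < y ^+ 2 by rewrite exprn_even_gt0.
have den t : alpha <= t <= beta -> 0 < (t - x) ^+ 2 + y ^+ 2 <= N.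
  move=> /andP[at_ tb]; rewrite ltr_wpDl ?sqr_ge0 //= lerD2r.
  have := sqr_ge0 (alpha - x); have := sqr_ge0 (beta - x).
  have [xt|tx] := leP x t.
    have : (t - x) ^+ 2 <= (beta - x) ^+ 2 by rewrite ler_sqr ?nnegrE; lra.
    lra.
  have : (x - t) ^+ 2 <= (x - alpha) ^+ 2 by rewrite ler_sqr ?nnegrE; lra.
  lra.
have N0 : 0 < N by rewrite ltr_wpDl // addr_ge0 ?sqr_ge0.
have E t : complex.Im ((t%:C - (x +i* y))^-1) = y / ((t - x) ^+ 2 + y ^+ 2).
  by rewrite /GRing.inv /= /invc /= add0r sqrrN mulNr opprK.
have int_cst c : (\int[mu]_(t in `[alpha, beta]) c) = c.
  exact: Rintegral_segment_cst.
have ii' : mu.-integrable `[alpha, beta]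
    (EFin \o (fun t => y / ((t - x) ^+ 2 + y ^+ 2))).
  by move: ii; congr (mu.-integrable _ (EFin \o _)); apply/funext => t; exact: E.
suff : complex.Im (f (x +i* y)) != 0 by apply: contraNneq => ->.
have -> : complex.Im (f (x +i* y)) =
    \int[mu]_(t in `[alpha, beta]) (y / ((t - x) ^+ 2 + y ^+ 2)).
  by rewrite fE //; apply: eq_Rintegral => t _; exact: E.
have [yp|yn] : 0 < y \/ y < 0 by apply/orP; rewrite -neq_lt eq_sym.
  rewrite gt_eqF //; apply: (@lt_le_trans _ _ (\int[mu]_(t in `[alpha, beta]) (y / N))).
    by rewrite int_cst divr_gt0.
  apply: le_Rintegral => // t /=; rewrite in_itv /= => /den /andP[d0 dN].
  by rewrite ler_pM2l // lef_pV2 ?posrE.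
rewrite lt_eqF //; apply: (@le_lt_trans _ _ (\int[mu]_(t in `[alpha, beta]) (y / N))).
  apply: le_Rintegral => // t /=; rewrite in_itv /= => /den /andP[d0 dN].
  by rewrite ler_nM2l // lef_pV2 ?posrE.
by rewrite int_cst pmulr_llt0 ?invr_gt0.
Qed.

End Markov.

(** * One step of the continued fraction *)

Section Step.
Context {R : realType}.
Variables (alpha beta : R).
Hypothesis hab : alpha < beta.
Implicit Types (l : R[i]) (f psi : R[i] -> R[i]).

Definition discrete_transform psi := exists n (x : 'I_n -> R) (w : 'I_n -> R[i]),
  [/\ forall k, 0 <= w k, \sum_k w k <= 1, forall k, alpha <= x k <= beta
    & forall l, off_segment alpha beta l -> psi l = \sum_k w k / ((x k)%:C - l)].

(** The order on complex numbers forces the compared values to be real; the two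
    cases are the two signs that a Cauchy transform takes on the real axis. *)
Definition dominated f psi := forall x : R,
  (beta < x -> f x%:C <= psi x%:C <= 0) /\ (x < alpha -> 0 <= psi x%:C <= f x%:C).

Variables (z : nat -> R[i]) (a1 a2 b : nat -> R) (j : nat).
Hypothesis b0 : 0 < b j.
Let D := denom z a1 a2 b j.

Lemma sqr_dist_real (x : R) (c : R[i]) :
  `|x%:C - c| ^+ 2 = (x%:C - c) * (x%:C - c^*).
Proof. by rewrite sqr_normc; congr (_ * _); case: c => u v; simpc. Qed.

(** In the coordinate w = 1/l, the function l f(l) extends through w = 0 by the
    value -1. *)
Lemma markov_lipschitz_at_infinity (mu : probability (measurableTypeR R) R) f :
  represented_by alpha beta mu f ->
  (exists2 r : R[i], 0 < r & forall w, w != 0 -> `|w| < r ->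
     off_segment alpha beta w^-1 /\ f w^-1 != 0) /\
  lipschitz_at 0 (fun w => if w == 0 then -1 else w^-1 * f w^-1).
Proof.
move=> hf; have [r [C [r0 C0 hrC]]] := markov_at_infinity hab hf.
have far w : w != 0 -> `|w| < r^-1 -> r < `|w^-1|.
  move=> w0 wr; rewrite normfV -[X in X < _]invrK ltf_pV2 ?posrE ?normr_gt0 //.
  by rewrite invr_gt0.
have bnd w : w != 0 -> `|w| < r^-1 -> `|w^-1 * f w^-1 + 1| <= C * `|w|.
  by move=> w0 wr; have [_] := hrC _ (far w w0 wr); rewrite normfV invrK.
have ri0 : 0 < r^-1 by rewrite invr_gt0.
have C1 : 0 < (C + 1)^-1 by rewrite invr_gt0 ltr_wpDl.
split.
  have [s [s0 sr sC]] := common_radius ri0 C1.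
  exists s => // w w0 ws; have wr := sr _ ws; have wC := sC _ ws.
  split; first by have [] := hrC _ (far w w0 wr).
  apply/eqP => f0; have := bnd w w0 wr; rewrite f0 mulr0 add0r normr1.
  suff : C * `|w| < 1 by move=> /lt_geF ->.
  rewrite (@le_lt_trans _ _ ((C + 1) * `|w|)) ?ler_wpM2r ?lerDl //.
  by rewrite mulrC -ltr_pdivlMr ?ltr_wpDl // div1r.
exists r^-1, C; split=> // w; rewrite subr0 eqxx => wr.
have [->|w0] := eqVneq w 0; first by rewrite subrr normr0 mulr0.
by rewrite opprK bnd.
Qed.

(** Comparing the values at infinity of the two sides of one expansion step:
    f and g both behave like -1/l, so the denominator behaves like
    (a2 - b^2) l and its leading coefficient must be 1. *)
Lemma coef_a2 (mu nu : probability (measurableTypeR R) R) f g :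
  represented_by alpha beta mu f -> represented_by alpha beta nu g ->
  (forall l, off_segment alpha beta l -> f l = - (D l (g l))^-1) ->
  a2 j = 1 + b j ^+ 2.
Proof.
move=> /markov_lipschitz_at_infinity[[r r0 hr] lf].
move=> /markov_lipschitz_at_infinity[_ lg] fE.
pose F w : R[i] := if w == 0 then -1 else w^-1 * f w^-1.
pose G w : R[i] := if w == 0 then -1 else w^-1 * g w^-1.
have lin c d : lipschitz_at 0 (fun w : R[i] => c + d * w).
  apply: lipschitz_atD; first exact: lipschitz_at_cst.
  by apply: lipschitz_atM; [exact: lipschitz_at_cst|exact: lipschitz_at_id].
(* l f(l) D(l) / l, written in the coordinate w = 1/l. *)
have lH := lipschitz_atM lf (lipschitz_atD (lin (a2 j)%:C (- (a1 j)%:C))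
  (lipschitz_atM (lipschitz_atM (lipschitz_atM (lipschitz_at_cst 0 ((b j)%:C ^+ 2))
     (lin 1 (- z j))) (lin 1 (- (z j)^*))) lg)).
have := lipschitz_at_eq lH (lipschitz_at_cst 0 (-1)) r0 _.
rewrite !mulr0 !addr0 !mulr1 eqxx => H.
have {H} : -1 * ((a2 j)%:C + (b j)%:C ^+ 2 * -1) = -1 :> R[i].
  apply: H => w w0; rewrite subr0 (negbTE w0) => wr.
  have [hw] := hr w w0 wr; rewrite fE // oppr_eq0 invr_eq0 => D0.
  rewrite mulrN mulNr; congr (- _); rewrite -[RHS](mulVf D0) mulrAC mulrC.
  congr (_ * _); rewrite /D /denom; field; exact: w0.
rewrite mulN1r => /oppr_inj /eqP; rewrite mulrN1 subr_eq -rmorphXn -(rmorph1 (real_complex R)).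
by rewrite -rmorphD => /eqP/complexI.
Qed.

Lemma off_segment_real (x : R) : off_segment alpha beta x%:C ->
  x < alpha \/ beta < x.
Proof.
move=> /off_segmentP h; have [xa|ax] := ltP x alpha; first by left.
have [bx|xb] := ltP beta x; first by right.
by have := h x; rewrite ax xb => /(_ isT); rewrite eqxx.
Qed.

Lemma real_off_segment (x : R) : x < alpha \/ beta < x ->
  off_segment alpha beta x%:C.
Proof.
move=> h; apply/off_segmentP => t /andP[at_ tb]; rewrite eq_complex /= eqxx andbT.
by apply/eqP => tx; subst t; case: h; rewrite ltNge ?at_ ?tb.
Qed.

(** The denominators of f and of its truncation differ by the nonnegative multiple
    b^2 |x - z|^2 of psi - g, so on each side of the segment the denominator of the
    truncation is the larger one in modulus and cannot vanish. *)
Lemma dominated_step (mu nu : probability (measurableTypeR R) R) f g psi :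
  represented_by alpha beta mu f -> represented_by alpha beta nu g ->
  (forall l, off_segment alpha beta l -> f l = - (D l (g l))^-1) ->
  dominated g psi ->
  (forall x : R, off_segment alpha beta x%:C -> D x%:C (psi x%:C) != 0) /\
  dominated f (fun l => - (D l (psi l))^-1).
Proof.
move=> hf hg fE gpsi.
have DE (x : R) : D x%:C (psi x%:C) - D x%:C (g x%:C) =
    (b j ^+ 2)%:C * `|x%:C - z j| ^+ 2 * (psi x%:C - g x%:C).
  rewrite sqr_dist_real /D /denom rmorphXn /=; ring.
have c0 (x : R) : 0 <= (b j ^+ 2)%:C * `|x%:C - z j| ^+ 2.
  by rewrite mulr_ge0 ?exprn_ge0 // lecR sqr_ge0.
have right (x : R) : beta < x ->
    0 < D x%:C (psi x%:C) /\ f x%:C <= - (D x%:C (psi x%:C))^-1 <= 0.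
  move=> bx; have hx := real_off_segment (or_intror bx).
  have f0 := (markov_real hab hf hx).1 bx; have /andP[gp _] := (gpsi x).1 bx.
  have Dg0 : 0 < D x%:C (g x%:C) by move: f0; rewrite fE // oppr_lt0 invr_gt0.
  have DgD : D x%:C (g x%:C) <= D x%:C (psi x%:C).
    by rewrite -subr_ge0 DE mulr_ge0 // subr_ge0.
  have D0 := lt_le_trans Dg0 DgD; split=> //.
  by rewrite fE // lerN2 lef_pV2 ?posrE // DgD oppr_le0 invr_ge0 ltW.
have left (x : R) : x < alpha ->
    0 < - D x%:C (psi x%:C) /\ 0 <= - (D x%:C (psi x%:C))^-1 <= f x%:C.
  move=> xa; have hx := real_off_segment (or_introl xa).
  have f0 := (markov_real hab hf hx).2 xa; have /andP[_ gp] := (gpsi x).2 xa.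
  have Dg0 : 0 < - D x%:C (g x%:C) by move: f0; rewrite fE // -invrN invr_gt0.
  have DgD : - D x%:C (g x%:C) <= - D x%:C (psi x%:C).
    by rewrite lerN2 -subr_le0 DE mulr_ge0_le0 // subr_le0.
  have D0 := lt_le_trans Dg0 DgD; split=> //.
  by rewrite fE // -!invrN lef_pV2 ?posrE // DgD invr_ge0 ltW.
split=> [x /off_segment_real [xa|bx]|x].
- by have [/lt0r_neq0] := left x xa; rewrite oppr_eq0.
- by have [/lt0r_neq0] := right x bx.
- by split=> [/right[]|/left[]].
Qed.

(** Partial fractions: (l - z)(l - conj z) / (x - l) is |x - z|^2 / (x - l) minus
    l + x - 2 Re z, so the denominator is p l - q + sum of v_k / (x_k - l) with
    positive v_k and p = a2 - b^2 (sum of the weights) >= 1.  Up to the factor -p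
    this is a secular function, and 1/p <= 1 is the total mass of the new
    measure. *)
Lemma discrete_step psi : discrete_transform psi -> a2 j = 1 + b j ^+ 2 ->
  (forall x : R, off_segment alpha beta x%:C -> D x%:C (psi x%:C) != 0) ->
  (forall l, off_segment alpha beta l -> D l (psi l) != 0) /\
  discrete_transform (fun l => - (D l (psi l))^-1).
Proof.
move=> [n [x [w [w0 w1 xab psiE]]]] a2E Dreal.
pose B := (b j ^+ 2)%:C : R[i].
have B0 : 0 < B by rewrite ltcR exprn_gt0.
pose p : R[i] := (a2 j)%:C - B * \sum_k w k.
have p1 : 1 <= p.
  rewrite /p a2E rmorphD rmorph1 -/B -addrA lerDl subr_ge0.
  by rewrite -[leRHS]mulr1 ler_wpM2l // ltW.
have p0 : 0 < p := lt_le_trans ltr01 p1.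
pose v k : R[i] := B * w k * `|(x k)%:C - z j| ^+ 2 / p.
have v0 k : 0 <= v k.
  by rewrite divr_ge0 ?mulr_ge0 ?exprn_ge0 // ltW.
pose q : R[i] := ((a1 j)%:C + B * \sum_k w k * ((x k)%:C - (z j + (z j)^*))) / p.
have cR (t : R) : t%:C \is Num.real by apply/complex_realP; exists t.
have wR k : w k \is Num.real by rewrite ger0_real.
have pR : p \is Num.real by rewrite gtr0_real.
have qR : q \is Num.real.
  apply: rpredM; last by rewrite rpredV.
  apply: rpredD; first exact: cR.
  apply: rpredM; first exact: cR.
  apply: rpred_sum => k _; apply: rpredM => //.
  by rewrite addcJ; apply: rpredB; rewrite ?cR // rpredM ?rpred_nat ?cR.
pose u k := sqrtC (v k).
have uR k : u k \is Num.real by rewrite ger0_real // sqrtC_ge0.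
have xl l : off_segment alpha beta l -> forall k, (x k)%:C != l.
  by move=> /off_segmentP h k; apply: h.
have DE l : off_segment alpha beta l ->
    D l (psi l) = - p * (q - l - \sum_k u k ^+ 2 / ((x k)%:C - l)).
  move=> hl; rewrite psiE // /D /denom.
  rewrite -[(b j)%:C ^+ 2]rmorphXn -/B.
  have -> : B * (l - z j) * (l - (z j)^*) * (\sum_k w k / ((x k)%:C - l)) =
     p * (\sum_k u k ^+ 2 / ((x k)%:C - l)) - (B * \sum_k w k) * l
     - B * \sum_k w k * ((x k)%:C - (z j + (z j)^*)).
    rewrite mulr_sumr [in RHS]mulr_sumr !mulr_sumr mulr_suml -!sumrN -!big_split /=.
    apply: eq_bigr => k _; rewrite sqrtCK /v sqr_dist_real.
    have := xl l hl k; rewrite -subr_eq0 => xk; field.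
    by rewrite xk gt_eqF.
  rewrite /q /p; set S1 := \sum_k w k; set S2 := \sum_k w k * _; field.
  by rewrite (_ : _ - _ = p) ?gt_eqF // /p /B rmorphXn.
have D0 l : off_segment alpha beta l -> D l (psi l) != 0.
  move=> hl; have [/complex_realP[t lt]|lnR] := boolP (l \is Num.real).
    by rewrite lt; apply: Dreal; rewrite -lt.
  rewrite DE //; apply: mulf_neq0; first by rewrite oppr_eq0 gt_eqF.
  exact: (secular_function_neq0 qR (fun k => cR (x k)) uR lnR).
split=> //.
have [y [m [m0 m1 hm]]] :=
  inv_secular_function qR (fun k => cR (x k)) uR.
have hy l : off_segment alpha beta l ->
    - (D l (psi l))^-1 = \sum_k (m k / p) / (y k - l) /\ forall k, y k = l -> m k = 0.
  move=> hl; have := D0 l hl; rewrite DE // => hD.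
  have sec0 : q - l - \sum_k u k ^+ 2 / ((x k)%:C - l) != 0.
    by apply: contraNneq hD => ->; rewrite mulr0.
  have [sE yE] := hm l (xl l hl) sec0; split=> //.
  rewrite mulNr invrN opprK invfM sE mulr_sumr; apply: eq_bigr => k _.
  by rewrite mulrC mulrAC.
(* Eigenvalues off the segment have weight 0, so they can be moved to alpha. *)
exists n.+1, (fun k => if `[< off_segment alpha beta (y k) >] then alpha
                       else complex.Re (y k)), (fun k => m k / p).
split.
- by move=> k; rewrite divr_ge0 // ltW.
- by rewrite -mulr_suml m1 mul1r invf_le1.
- move=> k; case: asboolP => [_|]; first by rewrite lexx ltW.
  by move=> /contrapT[t] /=; rewrite in_itv /= => tab <-.
- move=> l hl; have [-> _] := hy l hl; apply: eq_bigr => k _.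
  case: asboolP => [hyk|/contrapT[t _ <-] //].
  by have [_ /(_ k erefl) ->] := hy (y k) hyk; rewrite !mul0r.
Qed.

End Step.

(** * Error bounds from vanishing at prescribed poles *)

Section Contraction.
Context {R : realType}.
Variables (alpha beta : R).
Variables (L : (R -> R[i]) -> R[i]) (C : R[i]).
Hypothesis hL : bounded_functional alpha beta L C.
Hypothesis C0 : 0 <= C.
Variables (zeta e f : nat -> R[i]) (N : nat) (G : R[i] -> R[i]).
Hypothesis hzeta : forall i, off_segment alpha beta (zeta i).
Hypothesis hG : forall l, off_segment alpha beta l -> lipschitz_at l G.
Hypothesis FG : forall l, off_segment alpha beta l ->
  L (fun t => (t%:C - l)^-1) = \prod_(i < N) (l - zeta i) * G l.

Let num i (l : R[i]) : R[i] := e i * l + f i.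
Let weight m (t : R) : R[i] := \prod_(i < m) (num i t%:C / (t%:C - zeta i)).

Lemma bounded_measurable_weight m : bounded_measurable alpha beta (weight m).
Proof.
apply: bounded_measurable_prod => i.
apply: (bounded_measurable_div _ (@hzeta i)).
apply: bounded_measurableD; last exact: bounded_measurable_cst.
apply: bounded_measurableM; first exact: bounded_measurable_cst.
exact: bounded_measurable_real.
Qed.

(** Each factor e_i t + f_i over t - zeta_i can be absorbed by partial fractions, at
    the cost of the value of the current integral at zeta_i, and this value is 0
    thanks to the factor l - zeta_i of the right-hand side.  A repeated pole
    causes no trouble because the induction is on the formula at all points off
    the segment; the point l = zeta_m itself is reached by continuity. *)
Lemma functional_weight m l : (m <= N)%N -> off_segment alpha beta l ->
  L (fun t => weight m t / (t%:C - l)) =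
  \prod_(i < m) num i l * \prod_(m <= i < N) (l - zeta i) * G l.
Proof.
elim: m l => [|m IH] l mN hl.
  rewrite big_ord0 mul1r big_mkord -FG //; congr L; apply/funext => t.
  by rewrite /weight big_ord0 mul1r.
have mN' := ltnW mN; set s := zeta m.
have hs : off_segment alpha beta s := @hzeta m.
have bw := bounded_measurable_weight.
have neq k : off_segment alpha beta k -> forall t : R, alpha <= t <= beta -> t%:C - k != 0.
  by move=> /off_segmentP h t /h; rewrite subr_eq0.
(* The factor of index m in the product of the l - zeta_i is 0 at s. *)
have Is0 : L (fun t => weight m t / (t%:C - s)) = 0.
  by rewrite IH // big_ltn // subrr mul0r mulr0 mul0r.
have off k : off_segment alpha beta k -> k != s ->
    L (fun t => weight m.+1 t / (t%:C - k)) =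
    \prod_(i < m.+1) num i k * \prod_(m.+1 <= i < N) (k - zeta i) * G k.
  move=> hk ks; have ks0 : k - s != 0 by rewrite subr_eq0.
  have bk : bounded_measurable alpha beta (fun t => weight m t / (t%:C - k)).
    exact: bounded_measurable_div.
  have bs : bounded_measurable alpha beta (fun t => weight m t / (t%:C - s)).
    exact: bounded_measurable_div.
  transitivity (L (fun t => (num m k / (k - s)) * (weight m t / (t%:C - k)) +
      (- num m s / (k - s)) * (weight m t / (t%:C - s)))).
    apply: (functional_eq hL).
    - exact: bounded_measurable_div.
    - by apply: bounded_measurableD; apply: bounded_measurableM => //;
        exact: bounded_measurable_cst.
    move=> t tab; rewrite /weight big_ord_recr /= -/s /num; field.
    by rewrite ks0 !neq.
  rewrite hL.1 //; last by apply: bounded_measurableM bs; exact: bounded_measurable_cst.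
  rewrite (functionalZ hL) // Is0 mulr0 addr0 IH // big_ltn // big_ord_recr /= -/s.
  by field.
have [ls|] := eqVneq l s; last exact: off.
have [d d0 hd] := off_segment_near hl.
have lip k : off_segment alpha beta k ->
    lipschitz_at k (fun l => \prod_(i < m.+1) num i l *
      \prod_(m.+1 <= i < N) (l - zeta i) * G l).
  move=> hk; apply: lipschitz_atM (hG hk); apply: lipschitz_atM.
    apply: lipschitz_at_prod => i; apply: lipschitz_atD; last exact: lipschitz_at_cst.
    by apply: lipschitz_atM; [exact: lipschitz_at_cst|exact: lipschitz_at_id].
  apply: lipschitz_at_prod => i; apply: lipschitz_atD; first exact: lipschitz_at_id.
  exact: lipschitz_at_cst.
subst l; apply: (lipschitz_at_eq (lipschitz_at_functional hL C0 (bw m.+1) hl) (lip _ hl) d0).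
by move=> k ks kd; apply: off => //; have [] := hd k kd.
Qed.

(** With all N factors used up, the functional of the weighted kernel is the product
    of the numerators at l times G l, while without weights it is the product of
    the l - zeta_i times G l. *)
Lemma contraction_bound (k1 k2 d : R[i]) l : off_segment alpha beta l ->
  0 < d -> (forall t : R, alpha <= t <= beta -> d <= `|t%:C - l|) ->
  (forall i (t : R), alpha <= t <= beta -> `|num i t%:C / (t%:C - zeta i)| <= k1) ->
  0 < k2 -> (forall i, k2 * `|l - zeta i| <= `|num i l|) ->
  `|L (fun t => (t%:C - l)^-1)| <= C / d * (k1 / k2) ^+ N.
Proof.
move=> hl d0 hd hk1 k20 hk2.
have bound : `|\prod_(i < N) num i l * G l| <= C * (k1 ^+ N / d).
  have := functional_weight (leqnn N) hl; rewrite big_geq // mulr1 => <-.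
  apply: hL.2 => [|t tab]; first exact: bounded_measurable_div (bounded_measurable_weight N) hl.
  rewrite normrM normfV; apply: ler_pM; rewrite ?invr_ge0 //.
    rewrite /weight normr_prod -[X in _ ^+ X]card_ord -prodr_const.
    by apply: ler_prod => i _; rewrite normr_ge0 hk1.
  by rewrite lef_pV2 ?posrE ?hd // (lt_le_trans d0 (hd t tab)).
rewrite expr_div_n mulrA ler_pdivlMr ?exprn_gt0 //.
have -> : C / d * k1 ^+ N = C * (k1 ^+ N / d) by rewrite mulrAC mulrA.
apply: le_trans bound; rewrite FG // !normrM mulrAC ler_wpM2r // !normr_prod.
rewrite mulrC -[X in _ ^+ X]card_ord -prodr_const -big_split /=.
by apply: ler_prod => i _; rewrite mulr_ge0 ?(ltW k20) ?hk2.
Qed.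

End Contraction.

(** * Discs that separate the segment from the poles *)

Section Disc.
Context {R : realType}.
Implicit Types (u v l c : R[i]).

Definition sqr_mod u : R := complex.Re u ^+ 2 + complex.Im u ^+ 2.

Lemma sqr_modE u : `|u| ^+ 2 = (sqr_mod u)%:C.
Proof. by rewrite -add_Re2_Im2. Qed.

Lemma sqr_mod_ge0 u : 0 <= sqr_mod u.
Proof. by rewrite addr_ge0 ?sqr_ge0. Qed.

(** The identity behind the Blaschke factor of the circle |u|^2 = P: the pole v and
    the zero P / conj v are reflections of each other. *)
Lemma sqr_mod_reflection (P : R) u v :
  sqr_mod (P%:C - u * v^*%C) = P * sqr_mod (u - v) + (P - sqr_mod u) * (P - sqr_mod v).
Proof. by case: u v => a b [c d]; rewrite /sqr_mod; simpc => /=; ring. Qed.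

(** By the reflection identity the gain is (P - |u|^2)(|v|^2 - P) / |u - v|^2, which
    stays bounded below even when v tends to infinity; this is why the poles
    need not be bounded. *)
Lemma disc_contraction (S P Q : R) : 0 <= S -> S < P -> P < Q ->
  exists2 q : R, 0 < q < 1 & forall u v, sqr_mod u <= S -> Q <= sqr_mod v ->
    sqr_mod (P%:C - u * v^*%C) <= P * q ^+ 2 * sqr_mod (u - v).
Proof.
move=> S0 SP PQ; have P0 : 0 < P by apply: le_lt_trans SP.
have QP0 : 0 < Q + P by rewrite addr_gt0 // (lt_trans P0).
(* k is the minimum of (B - P) / (B + P) over B >= Q; the 2 in e comes from
   |u - v|^2 <= 2 (|u|^2 + |v|^2), and 1 - e/2 bounds the square root of 1 - e. *)
pose k := (Q - P) / (Q + P); pose e := (P - S) * k / (2 * P).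
have k0 : 0 < k by rewrite divr_gt0 // subr_gt0.
have k1 : k < 1 by rewrite ltr_pdivrMr // mul1r; lra.
have e0 : 0 < e by rewrite /e !(divr_gt0, mulr_gt0) ?subr_gt0.
have PeE : 2 * (P * e) = (P - S) * k by rewrite /e; field; rewrite gt_eqF.
have e1 : e < 1.
  rewrite ltr_pdivrMr ?mulr_gt0 // mul1r.
  have : (P - S) * k <= (P - S) * 1 by apply: ler_wpM2l; rewrite ?subr_ge0 ltW.
  lra.
exists (1 - e / 2) => [|u v uS Qv]; first by apply/andP; split; lra.
rewrite sqr_mod_reflection.
have W2 : sqr_mod (u - v) <= 2 * (sqr_mod u + sqr_mod v).
  case: (u) (v) => a b [c d]; rewrite /sqr_mod; simpc => /=.
  have := sqr_ge0 (a + c); have := sqr_ge0 (b + d); lra.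
set W := sqr_mod (u - v) in W2 *; set A := sqr_mod u in uS W2 *.
set B := sqr_mod v in Qv W2 *.
have W0 : 0 <= W := sqr_mod_ge0 _.
have hB : k * (B + P) <= B - P.
  rewrite /k mulrAC ler_pdivrMr //.
  have : 0 <= 2 * (P * (B - Q)) by rewrite !mulr_ge0 ?subr_ge0 // ltW.
  lra.
have h1 : P * e * W <= (P - A) * (B - P).
  apply: (@le_trans _ _ ((P - S) * (k * (B + P)))); last first.
    have B0 : 0 <= B := sqr_mod_ge0 _.
    apply: ler_pM; [lra| |lra|exact: hB].
    by rewrite (mulr_ge0 (ltW k0)) // addr_ge0 // ltW.
  have : P * e * W <= P * e * (2 * (P + B)).
    by apply: ler_wpM2l; [rewrite mulr_ge0 // ltW|lra].
  move/le_trans; apply; rewrite [X in _ <= X]mulrA -PeE; lra.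
have h2 : P * W * (1 - e) <= P * (1 - e / 2) ^+ 2 * W.
  have : 0 <= P * W * (e / 2) ^+ 2 by rewrite mulr_ge0 ?sqr_ge0 // mulr_ge0 // ltW.
  lra.
lra.
Qed.

(** A large disc centred far below the real axis is nearly a half-plane.  Its top
    is at height e above the axis, lower than delta and, off the axis, than l; the
    depth K of the centre is then tuned so that the disc meets the axis in a
    segment larger than [alpha, beta], which leaves out l when l is real. *)
Lemma separating_disc_upper (alpha beta delta : R) l :
  alpha < beta -> 0 < delta -> off_segment alpha beta l -> 0 <= complex.Im l ->
  exists c (S P Q : R), [/\ 0 <= S, S < P, P < Q,
    forall t : R, alpha <= t <= beta -> sqr_mod (t%:C - c) <= S &
    P < sqr_mod (l - c) /\ forall w, delta < complex.Im w -> Q <= sqr_mod (w - c)].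
Proof.
move=> hab d0; case: l => x y /= hl y0.
pose x0 := (alpha + beta) / 2; pose h := (beta - alpha) / 2.
have h0 : 0 < h by rewrite divr_gt0 // subr_gt0.
suff [K [e [K0 e0 ed hK hx]]] : exists K e : R,
    [/\ 0 < K, 0 < e, 2 * e <= delta, h ^+ 2 < 2 * K * e + e ^+ 2 &
      2 * K * e + e ^+ 2 < (x - x0) ^+ 2 + y ^+ 2 + 2 * K * y].
  have sqrK (s t : R) : 0 <= s -> s <= t -> s ^+ 2 <= t ^+ 2.
    by move=> s0 st; rewrite ler_sqr ?nnegrE // (le_trans s0).
  exists (x0 -i* K), (h ^+ 2 + K ^+ 2), ((K + e) ^+ 2), ((K + 2 * e) ^+ 2).
  split; rewrite ?addr_ge0 ?sqr_ge0 //.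
  - lra.
  - by rewrite ltr_sqr ?nnegrE; lra.
  - move=> t /andP[at_ tb]; rewrite /sqr_mod; simpc => /=.
    rewrite lerD2r -[leLHS]real_normK ?num_real // sqrK //.
    by rewrite ler_norml /x0 /h; lra.
  - split; first by rewrite /sqr_mod; simpc => /=; lra.
    case=> a b /= db; rewrite /sqr_mod; simpc => /=.
    have := sqrK (K + 2 * e) (b + K); have := sqr_ge0 (a - x0); lra.
have [y_eq0|y_neq0] := eqVneq y 0.
  subst y; have hx : h < `|x - x0|.
    rewrite ltNge; apply/negP => hx; move/off_segmentP: hl => /(_ x).
    by rewrite eqxx => hl; apply/notF/hl; move: hx; rewrite ler_norml /x0 /h; lra.
  (* The disc meets the axis in the segment of half-length sqrt s about x0, and s
     is taken halfway between the squares of h and of |x - x0|. *)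
  pose s := (h ^+ 2 + `|x - x0| ^+ 2) / 2.
  pose e := Num.min (delta / 2) (h / 2).
  have e0 : 0 < e by rewrite lt_min; apply/andP; split; exact: divr_gt0.
  have ed : e <= delta / 2 by rewrite ge_min lexx.
  have eh : e <= h / 2 by rewrite ge_min lexx orbT.
  have hx2 : h ^+ 2 < `|x - x0| ^+ 2 by rewrite ltr_sqr ?nnegrE // ltW.
  have e2 : e ^+ 2 < h ^+ 2 by rewrite ltr_sqr ?nnegrE; lra.
  exists ((s - e ^+ 2) / (2 * e)), e.
  have E : 2 * ((s - e ^+ 2) / (2 * e)) * e + e ^+ 2 = s by field; rewrite gt_eqF.
  rewrite E; split=> //; rewrite ?mulr0 ?expr0n ?addr0 /=; try (rewrite /s; lra).
  - by rewrite divr_gt0 ?mulr_gt0 // /s; lra.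
  - by rewrite -[X in _ < X]real_normK ?num_real // /s; lra.
have {y_neq0 y0}y0 : 0 < y by rewrite lt_def y_neq0.
pose e := Num.min (delta / 2) (y / 2).
have e0 : 0 < e by rewrite lt_min; apply/andP; split; exact: divr_gt0.
have ed : e <= delta / 2 by rewrite ge_min lexx.
have ey : e <= y / 2 by rewrite ge_min lexx orbT.
exists (h ^+ 2 / e), e.
have E : 2 * (h ^+ 2 / e) * e = 2 * h ^+ 2 by field; rewrite gt_eqF.
have h20 : 0 < h ^+ 2 by rewrite exprn_gt0.
have e20 : 0 < e ^+ 2 by rewrite exprn_gt0.
have K0 : 0 < h ^+ 2 / e by rewrite divr_gt0.
rewrite E; split=> //; try lra.
have : 2 * (h ^+ 2 / e) * e <= 2 * (h ^+ 2 / e) * y.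
  by apply: ler_wpM2l; [rewrite mulr_ge0 // ltW|lra].
have : e ^+ 2 < y ^+ 2 by rewrite ltr_sqr ?nnegrE; lra.
have := sqr_ge0 (x - x0); rewrite E; lra.
Qed.

Lemma sqr_mod_subJ u v : sqr_mod (u^*%C - v) = sqr_mod (u - v^*%C).
Proof. by case: u v => a b [c d]; rewrite /sqr_mod; simpc => /=; ring. Qed.

(** Reflection in the real axis preserves the segment and exchanges the two
    half-planes, hence the conjugates of w in the second case. *)
Lemma separating_disc (alpha beta delta : R) l :
  alpha < beta -> 0 < delta -> off_segment alpha beta l ->
  exists c (S P Q : R), [/\ 0 <= S, S < P, P < Q,
    forall t : R, alpha <= t <= beta -> sqr_mod (t%:C - c) <= S &
    P < sqr_mod (l - c) /\
    ((forall w, delta < complex.Im w -> Q <= sqr_mod (w - c)) \/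
     (forall w, delta < complex.Im w -> Q <= sqr_mod (w^*%C - c)))].
Proof.
move=> hab d0 hl; have [Il|Il] := leP 0 (complex.Im l).
  have [c [S [P [Q [? ? ? ? [? ?]]]]]] := separating_disc_upper hab d0 hl Il.
  by exists c, S, P, Q; split=> //; split=> //; left.
have hl' : off_segment alpha beta l^*%C.
  apply/off_segmentP => t tab; have /off_segmentP/(_ t tab) := hl.
  by apply: contraNneq => /(congr1 conjc); rewrite conjcK conjc_real => ->.
have [|c [S [P [Q [S0 SP PQ hS [hP hQ]]]]]] := separating_disc_upper hab d0 hl'.
  by move: Il; case: (l) => a b /=; rewrite oppr_ge0 => /ltW.
exists c^*%C, S, P, Q; split=> //.
  move=> t tab; rewrite -sqr_mod_subJ.
  have -> : (t%:C)^*%C = t%:C :> R[i] by simpc.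
  exact: hS.
split; first by rewrite -sqr_mod_subJ.
by right=> w /hQ; rewrite sqr_mod_subJ conjcK.
Qed.

End Disc.

(** * Convergence of the convergents *)

Section Convergents.
Context {R : realType}.
Variables (alpha beta : R).
Hypothesis hab : alpha < beta.
Variables (phi : R[i] -> R[i]) (sigma : probability (measurableTypeR R) R).
Hypothesis hphi : represented_by alpha beta sigma phi.
Variables (z : nat -> R[i]) (phi_ : nat -> R[i] -> R[i]) (a1 a2 b : nat -> R).
Hypothesis hexp : step_by_step alpha beta z phi phi_ a1 a2 b.

(** The expansion of phi_j cut after k steps, the remaining tail being replaced by
    0. *)
Fixpoint truncation (k j : nat) (l : R[i]) : R[i] :=
  if k is k'.+1 then - (denom z a1 a2 b j l (truncation k' j.+1 l))^-1 else 0.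

Lemma tail_convergent_truncation k j l :
  tail_convergent z a1 a2 b k j l = truncation k.+1 j l.
Proof.
elim: k j => [|k IH] j /=; last by rewrite IH.
by rewrite /denom mulr0 addr0.
Qed.

Lemma markov_phi_ j : exists mu : probability (measurableTypeR R) R,
  represented_by alpha beta mu (phi_ j).
Proof.
case: hexp => phi0 step; case: j => [|j]; first by exists sigma; rewrite phi0.
by have [_ ? _] := step j.
Qed.

Lemma phi_E j l : off_segment alpha beta l ->
  phi_ j l = - (denom z a1 a2 b j l (phi_ j.+1 l))^-1.
Proof. by case: hexp => _ /(_ j)[_ _]; apply. Qed.

Lemma b_gt0 j : 0 < b j.
Proof. by case: hexp => _ /(_ j)[]. Qed.

Lemma a2E j : a2 j = 1 + b j ^+ 2.
Proof.
have [mu hmu] := markov_phi_ j; have [nu hnu] := markov_phi_ j.+1.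
by apply: (coef_a2 hab hmu hnu); exact: phi_E.
Qed.

Lemma truncation_transform k j :
  dominated alpha beta (phi_ j) (truncation k j) /\
  discrete_transform alpha beta (truncation k j).
Proof.
elim: k j => [|k IH] j; have [mu hmu] := markov_phi_ j.
  split=> [x|].
    split=> h.
      have hx := real_off_segment (or_intror h : x < alpha \/ beta < x).
      by rewrite /= lexx andbT ltW // (markov_real hab hmu hx).1.
    have hx := real_off_segment (or_introl h : x < alpha \/ beta < x).
    by rewrite /= lexx ltW // (markov_real hab hmu hx).2.
  exists 0, (fun=> alpha), (fun=> 0).
  by split=> [k||k|l _]; rewrite ?big_ord0 ?ler01 // lexx ltW.
have [nu hnu] := markov_phi_ j.+1; have [dom disc] := IH j.+1.
have [D0 dom'] := dominated_step hab hmu hnu (@phi_E j) dom.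
by split=> //; have [] := discrete_step hab (b_gt0 j) disc (a2E j) D0.
Qed.

Lemma denom_truncation_neq0 k j l : off_segment alpha beta l ->
  denom z a1 a2 b j l (truncation k j.+1 l) != 0.
Proof.
have [mu hmu] := markov_phi_ j.
have [nu hnu] := markov_phi_ j.+1; have [dom disc] := truncation_transform k j.+1.
have [D0 _] := dominated_step hab hmu hnu (@phi_E j) dom.
by have [+ _] := discrete_step hab (b_gt0 j) disc (a2E j) D0; apply.
Qed.

Lemma denom_phi_neq0 j l : off_segment alpha beta l ->
  denom z a1 a2 b j l (phi_ j.+1 l) != 0.
Proof.
move=> hl; have [mu hmu] := markov_phi_ j.
by have := markov_neq0 hab hmu hl; rewrite phi_E // oppr_eq0 invr_eq0.
Qed.

Lemma lipschitz_at_phi_ j l : off_segment alpha beta l -> lipschitz_at l (phi_ j).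
Proof.
move=> hl; have [mu [_ muE]] := markov_phi_ j.
have hL := bounded_functional_integral hab mu.
have [|r [C [r0 hC]]] :=
  lipschitz_at_functional hL _ (bounded_measurable_cst alpha beta 1) hl => //.
have [d d0 hd] := off_segment_near hl.
have [t [t0 tr td]] := common_radius r0 d0.
exists t, C; split=> // k kl; have [hk _] := hd k (td _ kl).
rewrite !muE //; have := hC k (tr _ kl).
have E m : (fun t : R => 1 / (t%:C - m)) = (fun t : R => (t%:C - m)^-1).
  by apply/funext => u; rewrite mul1r.
by rewrite !E.
Qed.

Lemma lipschitz_at_truncation k j l : off_segment alpha beta l ->
  lipschitz_at l (truncation k j).
Proof.
move=> hl; have [_ [n [x [w [w0 w1 xab wE]]]]] := truncation_transform k j.
have hL := bounded_functional_sum hab w0 w1 xab.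
have [|r [C [r0 hC]]] :=
  lipschitz_at_functional hL _ (bounded_measurable_cst alpha beta 1) hl => //.
have [d d0 hd] := off_segment_near hl.
have [t [t0 tr td]] := common_radius r0 d0.
exists t, C; split=> // m ml; have [hm _] := hd m (td _ ml).
rewrite !wE //; have := hC m (tr _ ml).
have E y : \sum_k w k * (1 / ((x k)%:C - y)) = \sum_k w k / ((x k)%:C - y).
  by apply: eq_bigr => i _; rewrite mul1r.
by rewrite !E.
Qed.

(** Subtracting two expansion steps with the same coefficients multiplies the
    error of the next level by b^2 (l - z)(l - conj z) f f', where f and f' are the
    two values of the current level. *)
Lemma error_product k j : exists G : R[i] -> R[i],
  (forall l, off_segment alpha beta l -> lipschitz_at l G) /\
  forall l, off_segment alpha beta l -> phi_ j l - truncation k j l =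
    \prod_(i < k) ((l - z (j + i)) * (l - (z (j + i))^*)) * G l.
Proof.
elim: k j => [|k IH] j.
  exists (phi_ j); split=> [l|l _]; first exact: lipschitz_at_phi_.
  by rewrite big_ord0 mul1r subr0.
have [G [lG GE]] := IH j.+1.
exists (fun l => (b j)%:C ^+ 2 * (phi_ j l * truncation k.+1 j l) * G l).
split=> [l hl|l hl].
  apply: lipschitz_atM (lG l hl); apply: lipschitz_atM; first exact: lipschitz_at_cst.
  by apply: lipschitz_atM; [exact: lipschitz_at_phi_|exact: lipschitz_at_truncation].
have -> : phi_ j l - truncation k.+1 j l = (b j)%:C ^+ 2 * (phi_ j l * truncation k.+1 j l) *
    ((l - z j) * (l - (z j)^*)) * (phi_ j.+1 l - truncation k j.+1 l).
  have := denom_truncation_neq0 k j hl; have := denom_phi_neq0 j hl.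
  rewrite [phi_ j l]phi_E //= /denom => u0 v0.
  by field; rewrite u0 v0.
rewrite GE // big_ord_recl addn0.
under eq_bigr do rewrite addSnnS.
by ring.
Qed.

Variables (delta : R).
Hypothesis hdelta : 0 < delta.
Hypothesis hz : forall k, delta < complex.Im (z k).

Lemma off_segment_z k : off_segment alpha beta (z k) /\ off_segment alpha beta (conjc (z k)).
Proof.
have := lt_trans hdelta (hz k); case: (z k) => x y /= y0.
split; apply/off_segmentP => t _; apply/eqP => -[_ yE]; move: y0.
  by rewrite -yE ltxx.
by rewrite -oppr_lt0 -yE ltxx.
Qed.

(** A disc below the line of height delta keeps away from the z_k, its mirror image
    from their conjugates; the half-plane of l0 decides which one leaves out l0. *)
Lemma pole_choice l0 : off_segment alpha beta l0 ->
  exists c (S P Q : R) (zeta eta : nat -> R[i]),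
  [/\ [/\ 0 <= S, S < P & P < Q],
    forall t : R, alpha <= t <= beta -> sqr_mod (t%:C - c) <= S,
    P < sqr_mod (l0 - c),
    forall i, off_segment alpha beta (zeta i) /\ Q <= sqr_mod (zeta i - c) &
    forall i l, (l - z i) * (l - (z i)^*) = (l - zeta i) * (l - eta i)].
Proof.
move=> hl0; have [c [S [P [Q [S0 SP PQ hS [hP [hQ|hQ]]]]]]] := separating_disc hab hdelta hl0.
  exists c, S, P, Q, z, (fun i => conjc (z i)); split=> // i.
  by split; [have [] := off_segment_z i|exact: hQ].
exists c, S, P, Q, (fun i => conjc (z i)), z; split=> // [i|i l].
  by split; [have [] := off_segment_z i|exact: hQ].
by rewrite mulrC.
Qed.

Lemma le_of_sqr_mod (k : R) (u v : R[i]) : 0 <= k ->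
  k ^+ 2 * sqr_mod u <= sqr_mod v -> k%:C * `|u| <= `|v|.
Proof.
move=> k0 h; rewrite -(@ler_pXn2r _ 2) ?nnegrE ?mulr_ge0 ?normr_ge0 ?ler0c //.
by rewrite exprMn !sqr_modE -rmorphXn -rmorphM lecR.
Qed.

Lemma geometric_error l0 : off_segment alpha beta l0 ->
  exists (r C : R[i]) (q : R), [/\ 0 < r, 0 <= C, 0 < q < 1 &
    forall l, `|l - l0| < r -> off_segment alpha beta l /\
      forall k, `|phi l - truncation k 0 l| <= C * q%:C ^+ k].
Proof.
move=> hl0.
have [c [S [P [Q [zeta [eta [[S0 SP PQ] hS hP hzeta zE]]]]]]] := pole_choice hl0.
have P0 : 0 < P by apply: le_lt_trans SP.
have [q /andP[q0 q1] hq] := disc_contraction S0 SP PQ.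
pose p := Num.sqrt P; have p0 : 0 < p by rewrite sqrtr_gt0.
have p2 : p ^+ 2 = P by rewrite sqr_sqrtr // ltW.
have [d d0 hd] := off_segment_near hl0.
have gap : 0 < `|l0 - c| - p%:C.
  rewrite subr_gt0 -(@ltr_pXn2r _ 2) ?nnegrE ?normr_ge0 ?ler0c ?(ltW p0) //.
  by rewrite sqr_modE -rmorphXn ltcR p2.
have [r [r0 rd rgap]] := common_radius d0 gap.
exists r, (3 / d), q; split=> //; first by rewrite divr_ge0 // ltW.
  by rewrite q0.
move=> l hr; have [hl ld] := hd l (rd _ hr); split=> // k.
have outside : P <= sqr_mod (l - c).
  have : p%:C <= `|l - c|.
    have := ler_distD l l0 c; rewrite [`|l0 - l|]distrC -lerBlDl; apply: le_trans.
    by rewrite lerBrDr -lerBrDl ltW // rgap.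
  rewrite -(@ler_pXn2r _ 2) ?nnegrE ?normr_ge0 ?ler0c ?(ltW p0) //.
  by rewrite sqr_modE -rmorphXn lecR p2.
have [_ [n [x [w [w0 w1 xab wE]]]]] := truncation_transform k 0.
have [phi0 _] := hexp; have [_ phiE] := hphi.
have hL := bounded_functional_sub (bounded_functional_integral hab sigma)
  (bounded_functional_sum hab w0 w1 xab).
have [G [lG GE]] := error_product k 0.
pose G' l := \prod_(i < k) (l - eta i) * G l.
have lG' m : off_segment alpha beta m -> lipschitz_at m G'.
  move=> hm; apply: lipschitz_atM (lG m hm); apply: lipschitz_at_prod => i.
  by apply: lipschitz_atD; [exact: lipschitz_at_id|exact: lipschitz_at_cst].
pose L f := complex_integral sigma `[alpha, beta] f - \sum_k w k * f (x k).
have errE m : off_segment alpha beta m ->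
    L (fun t => (t%:C - m)^-1) = phi m - truncation k 0 m.
  by move=> hm; rewrite /L -phiE // wE.
have FG m : off_segment alpha beta m ->
    L (fun t => (t%:C - m)^-1) = \prod_(i < k) (m - zeta i) * G' m.
  move=> hm; rewrite errE // -phi0 GE // mulrA -big_split /=; congr (_ * _).
  by apply: eq_bigr => i _; rewrite add0n zE.
(* Blaschke factors of the exterior of the disc of centre c, up to constants. *)
pose e i : R[i] := - conjc (zeta i - c).
pose f i : R[i] := P%:C + c * conjc (zeta i - c).
have numE i m : e i * m + f i = P%:C - (m - c) * conjc (zeta i - c).
  by rewrite /e /f; ring.
have subE i m : (m - c) - (zeta i - c) = m - zeta i by ring.
have := @contraction_bound _ _ _ L (2 + 1) hL _ zeta e f k G' _ lG' FG
  (p * q)%:C p%:C d l hl d0 ld _ _ _.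
rewrite errE // (_ : (p * q)%:C / p%:C = q%:C); last first.
  by rewrite rmorphM /= mulrAC mulfV ?mul1r // gt_eqF // ltcR.
have -> : 2 + 1 = 3 :> R[i] by ring.
apply=> //.
- by move=> i; have [] := hzeta i.
- move=> i t tab; have [hi Qi] := hzeta i.
  have tz : 0 < `|t%:C - zeta i|.
    by rewrite normr_gt0 subr_eq0; have /off_segmentP := hi; apply.
  rewrite normrM normfV ler_pdivrMr // numE.
  rewrite -(@ler_pXn2r _ 2) ?nnegrE ?mulr_ge0 ?normr_ge0 ?ler0c //;
    last exact: mulr_ge0 (ltW p0) (ltW q0).
  rewrite exprMn !sqr_modE -rmorphXn -rmorphM lecR exprMn p2 -(subE i).
  exact: hq (hS t tab) Qi.
- by rewrite ltcR.
- move=> i; apply: le_of_sqr_mod; first exact: ltW.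
  rewrite numE sqr_mod_reflection p2 (subE i) lerDl mulr_le0 ?subr_le0 //.
  by have [_ Qi] := hzeta i; rewrite (le_trans (ltW PQ)).
Qed.

(** The index k is left free above n because the convergents and the interpolants
    are the same truncations with indices shifted by one. *)
Lemma truncation_locally_uniform (g : nat -> R[i] -> R[i]) :
  (forall n l, (0 < n)%N -> off_segment alpha beta l ->
     exists2 k, (n <= k)%N & g n l = truncation k 0 l) ->
  locally_uniformly_cvg (off_segment alpha beta) g phi.
Proof.
move=> gE l0 hl0; have [r [C [q [r0 C0 /andP[q0 q1] hr]]]] := geometric_error hl0.
exists [set l | `|l - l0| < r].
  by apply/nbhs_ballP; exists r => // l; rewrite /ball /= distrC.
move=> P /uniform_nbhs[E [entE EP]].
have [e e0 eE] : exists2 e : R[i], 0 < e & forall u v, `|u - v| < e -> E (u, v).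
  move: entE; rewrite -entourage_ballE => -[e e0 eE]; exists e => // u v uv.
  exact: eE.
have C1 : 0 < C + 1 by rewrite ltr_wpDl.
pose s := complex.Re (e / (C + 1)).
have sE : e / (C + 1) = s%:C by rewrite /s RRe_real // gtr0_real // divr_gt0.
have s0 : 0 < s by rewrite -ltcR -sE divr_gt0.
have : \forall n \near \oo, q ^+ n < s.
  have qn : `|q| < 1 by rewrite ger0_norm // ltW.
  have /cvgrPdist_lt hq := cvg_expr qn.
  apply: filterS (hq s s0) => n; rewrite sub0r normrN.
  exact: le_lt_trans (ler_norm _).
move=> [N _ hN]; exists N.+1 => //= n /= Nn; apply: EP => l /= lr.
apply: eE; have [hl hk] := hr l lr.
have [k nk ->] := gE n l (leq_ltn_trans (leq0n N) Nn) hl; rewrite (le_lt_trans (hk k)) //.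
rewrite (@le_lt_trans _ _ ((C + 1) * q%:C ^+ k)) //.
  by rewrite ler_wpM2r ?exprn_ge0 ?ler0c ?(ltW q0) // lerDl.
rewrite mulrC -ltr_pdivlMr // sE -rmorphXn ltcR; apply: hN => /=.
exact: ltnW (leq_trans Nn nk).
Qed.

End Convergents.

(** * Uniqueness of the multipoint approximants *)

Lemma dnbhs0_radius (R : realType) (P : R[i] -> Prop) :
  (\forall w \near (0 : R[i])^', P w) ->
  exists2 r : R[i], 0 < r & forall w, w != 0 -> `|w| < r -> P w.
Proof.
move=> /nbhs_ballP[r r0 h]; exists r => // w w0 wr; apply: h => //.
by rewrite /ball /= sub0r normrN.
Qed.

Section CountSome.
Context {T : eqType}.
Implicit Types (c : T) (s : seq T).

Lemma count_mem_None s : count_mem None (None :: map Some s) = 1%N.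
Proof. by rewrite /= count_map (eq_count (a2 := pred0)) ?count_pred0. Qed.

Lemma count_mem_Some c s : count_mem (Some c) (None :: map Some s) = count_mem c s.
Proof. by rewrite /= add0n count_map; apply: eq_count. Qed.

End CountSome.

Section Uniqueness.
Context {R : realType}.
Variables (alpha beta : R).
Hypothesis hab : alpha < beta.
Variables (phi : R[i] -> R[i]) (sigma : probability (measurableTypeR R) R).
Hypothesis hphi : represented_by alpha beta sigma phi.
Variables (z : nat -> R[i]) (phi_ : nat -> R[i] -> R[i]) (a1 a2 b : nat -> R).
Hypothesis hexp : step_by_step alpha beta z phi phi_ a1 a2 b.
Variables (delta : R).
Hypothesis hdelta : 0 < delta.
Hypothesis hz : forall k, delta < complex.Im (z k).

Let T := truncation z a1 a2 b.

(** Numerator and denominator of the truncation, by the backward recurrence and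
    without cancellation. *)
Fixpoint fraction (k j : nat) : {poly R[i]} * {poly R[i]} :=
  if k is k'.+1 then
    let: (A, B) := fraction k' j.+1 in
    (- B, ((a2 j)%:C *: 'X - (a1 j)%:C%:P) * B +
          (b j)%:C ^+ 2 *: (('X - (z j)%:P) * ('X - ((z j)^*%C)%:P) * A))
  else (0, 1).

Lemma fractionS k j : fraction k.+1 j =
    (- (fraction k j.+1).2, ((a2 j)%:C *: 'X - (a1 j)%:C%:P) * (fraction k j.+1).2 +
     (b j)%:C ^+ 2 *: (('X - (z j)%:P) * ('X - ((z j)^*%C)%:P) * (fraction k j.+1).1)).
Proof. by rewrite /=; case: (fraction k j.+1). Qed.

Lemma fractionE k j l : off_segment alpha beta l ->
  (fraction k j).2.[l] != 0 /\ T k j l = (fraction k j).1.[l] / (fraction k j).2.[l].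
Proof.
move=> hl; elim: k j => [|k IH] j; first by rewrite /= hornerE oner_neq0 horner0 mul0r.
have [B0 TE] := IH j.+1; rewrite fractionS /=.
have D0 := denom_truncation_neq0 hab hphi hexp k j hl.
have -> : (((a2 j)%:C *: 'X - (a1 j)%:C%:P) * (fraction k j.+1).2 +
  (b j)%:C ^+ 2 *: (('X - (z j)%:P) * ('X - ((z j)^*%C)%:P) * (fraction k j.+1).1)).[l] =
    (fraction k j.+1).2.[l] * denom z a1 a2 b j l (T k j.+1 l).
  by rewrite TE /denom !(hornerD, hornerN, hornerM, hornerZ, hornerX, hornerC); field.
split; first exact: mulf_neq0.
by rewrite hornerN mulNr invfM mulrA mulfV // mul1r.
Qed.

(** The degree of the denominator is exact because its leading coefficient never
    decreases: a2 = 1 + b^2, and at infinity the truncation is -m/l with a mass m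
    between 0 and 1, which bounds the coefficient of degree k - 1 of the
    numerator.  That coefficient is written as the k-th one after multiplication
    by X, to avoid the predecessor of k. *)
Lemma fraction_size k j : size (fraction k j).2 = k.+1 /\ (size (fraction k j).1 <= k)%N.
Proof.
suff [sB sA [c0 _ _]] : [/\ (size (fraction k j).2 <= k.+1)%N, (size (fraction k j).1 <= k)%N
  & [/\ 0 < (fraction k j).2`_k, ('X * (fraction k j).1)`_k <= 0
   & - (fraction k j).2`_k <= ('X * (fraction k j).1)`_k]].
  split=> //; apply/eqP; rewrite eqn_leq sB ltnNge; apply: contraTN c0 => h.
  by rewrite nth_default ?ltxx.
elim: k j => [|k IH] j.
  rewrite -[(fraction 0 j).2]/(1 : {poly R[i]}) -[(fraction 0 j).1]/(0 : {poly R[i]}).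
  have c1 : (1 : {poly R[i]})`_0 = 1 by rewrite coef1.
  have x0 : ('X * (0 : {poly R[i]}))`_0 = 0 by rewrite coefXM.
  split; [by rewrite size_poly1|by rewrite size_poly0|].
  rewrite c1 x0.
  split; [exact: ltr01|exact: lexx|].
  by rewrite lerNl oppr0 ler01.
have [sB sA [c0 n0 cn]] := IH j.+1; rewrite fractionS /=.
set A := (fraction k j.+1).1 in sA n0 cn *; set B := (fraction k j.+1).2 in sB c0 cn *.
have BE : (((a2 j)%:C *: 'X - (a1 j)%:C%:P) * B +
   (b j)%:C ^+ 2 *: (('X - (z j)%:P) * ('X - ((z j)^*%C)%:P) * A))`_k.+1 =
   (a2 j)%:C * B`_k + (b j)%:C ^+ 2 * ('X * A)`_k.
  have -> : ((a2 j)%:C *: 'X - (a1 j)%:C%:P) * B +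
   (b j)%:C ^+ 2 *: (('X - (z j)%:P) * ('X - ((z j)^*%C)%:P) * A) =
   (a2 j)%:C *: ('X * B) - (a1 j)%:C *: B + (b j)%:C ^+ 2 *: ('X * ('X * A)
     - (z j + (z j)^*%C) *: ('X * A) + (z j * (z j)^*%C) *: A).
    by rewrite -!mul_polyC !rmorphD !rmorphM /=; ring.
  rewrite !(coefD, coefN, coefZ, coefXM) /= [B`_k.+1]nth_default // [A`_k]nth_default //.
  by rewrite [A`_k.+1]nth_default ?(leqW sA) // !mulr0 !subr0 !addr0.
have grow : B`_k <= (a2 j)%:C * B`_k + (b j)%:C ^+ 2 * ('X * A)`_k.
  rewrite (a2E hab hphi hexp) rmorphD rmorph1 mulrDl mul1r -addrA lerDl rmorphXn.
  by rewrite -mulrDr mulr_ge0 // -?lerBlDl ?sub0r // -rmorphXn lecR sqr_ge0.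
split.
- rewrite (leq_trans (size_polyD _ _)) // geq_max; apply/andP; split.
    have h : (size ((a2 j)%:C *: 'X - (a1 j)%:C%:P)%R <= 2)%N.
      rewrite (leq_trans (size_polyD _ _)) // geq_max size_polyN.
      rewrite (leq_trans (size_scale_leq _ _)) ?size_polyX //=.
      by rewrite (leq_trans (size_polyC_leq1 _)).
    rewrite (leq_trans (size_polyMleq _ _)) // -subn1 leq_subLR add1n.
    by rewrite (leq_trans (leq_add h sB)).
  rewrite (leq_trans (size_scale_leq _ _)) // (leq_trans (size_polyMleq _ _)) //.
  have := size_polyMleq ('X - (z j)%:P) ('X - ((z j)^*%C)%:P); rewrite !size_XsubC => h.
  by rewrite -subn1 leq_subLR add1n (leq_trans (leq_add h sA)).
- by rewrite size_polyN.
- have -> : ('X * - B)`_k.+1 = - B`_k by rewrite coefXM coefN.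
  rewrite BE; split; first exact: lt_le_trans c0 grow.
    by rewrite oppr_le0 ltW.
  by rewrite lerN2.
Qed.

(** A common root would be a root of the quadratic factor, that is z_j or its
    conjugate; but denominators have no root off the segment. *)
Lemma fraction_coprime k j : coprimep (fraction k j).1 (fraction k j).2.
Proof.
apply/Pdiv.ClosedField.coprimepP => x.
elim: k j => [|k IH] j; first by rewrite /= hornerC oner_neq0.
rewrite fractionS /= rootN rootE => B0.
rewrite !(hornerD, hornerN, hornerM, hornerZ, hornerX, hornerC).
have A0 : (fraction k j.+1).1.[x] != 0.
  by apply: contraL B0 => /eqP A0; apply: IH; rewrite rootE A0.
have off_x : ~ off_segment alpha beta x.
  by move=> /(fractionE k j.+1)[]; rewrite B0.
have [hz1 hz2] := off_segment_z alpha beta hdelta hz j.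
rewrite (eqP B0) mulr0 add0r; apply: mulf_neq0.
  by rewrite expf_neq0 // gt_eqF // ltcR (b_gt0 hexp).
apply: mulf_neq0 A0; apply: mulf_neq0; rewrite subr_eq0;
  by apply/eqP => xE; apply: off_x; rewrite xE.
Qed.

Definition node k : R[i] := if odd k then (z k./2)^*%C else z k./2.

Lemma prod_nodes m l :
  (\prod_(c <- [seq node k | k <- iota 0 m.*2]) ('X - c%:P)).[l] =
  \prod_(i < m) ((l - z i) * (l - (z i)^*%C)).
Proof.
rewrite horner_prod big_map; under eq_bigr do rewrite hornerXsubC.
rewrite -[m.*2]subn0 -/(index_iota 0 m.*2).
elim: m => [|m IH]; first by rewrite big_geq // big_ord0.
rewrite doubleS !big_nat_recr //= big_ord_recr /= IH -mulrA.
by rewrite /node /= odd_double /= !doubleK uphalf_double.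
Qed.

Lemma pade_points_seq m :
  [seq pade_points z k | k <- iota 0 m.+1] = None :: [seq Some (node k) | k <- iota 0 m].
Proof.
by rewrite /= -[1%N]addn0 iotaDl -map_comp; congr cons; apply: eq_map => k.
Qed.

(** Both p/q and A/B have contact with phi at the 2n+2 nodes, so p B - A q is
    divisible by a polynomial of degree 2n+2; contact at infinity lowers the degree
    of p below n+1, so that p B - A q has degree at most 2n+1. *)
Lemma pade_eq_truncation n (r : R[i] -> R[i]) l :
  multipoint_pade (pade_points z) phi n.+1 n.+1 r -> off_segment alpha beta l ->
  r l = T n.+1 0 l.
Proof.
move=> [[p [q [sp sq q0 rE]]]]; rewrite pade_points_seq => agree hl.
set nodes := [seq node k | k <- iota 0 n.+1.*2].
have nodesE : [seq Some (node k) | k <- iota 0 (n.+1 + n.+1)] = map Some nodes.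
  by rewrite -map_comp addnn.
rewrite nodesE in agree; cbv zeta in agree.
pose A := (fraction n.+1 0).1; pose B := (fraction n.+1 0).2.
have [sB sA] : size B = n.+2 /\ (size A <= n.+1)%N := fraction_size n.+1 0.
have AB m : off_segment alpha beta m -> B.[m] != 0 /\ T n.+1 0 m = A.[m] / B.[m].
  exact: fractionE.
have [phi0 _] := hexp.
have sp' : (size p <= n.+1)%N.
  have [|C hC] := agree None; first by rewrite inE eqxx.
  have [s s0 hs] := dnbhs0_radius hC.
  have cN : count_mem None (None :: map Some nodes) = 1%N.
    exact: count_mem_None.
  have [_ [t [D [t0 hD]]]] := markov_lipschitz_at_infinity hab hphi.
  have [u [u0 us ut]] := common_radius s0 t0.
  apply: (@size_le_of_infinity _ _ p q (C + (D * u + 1)) u u0 sp sq q0) => w w0 wu qw0.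
  have := hs w w0 (us _ wu); rewrite cN expr1 /= rE // => h1.
  have := hD w; rewrite subr0 eqxx (negbTE w0) => /(_ (ut _ wu)) h2.
  have D0 : 0 <= D.
    have := le_trans (normr_ge0 _) h2; by rewrite pmulr_lge0 // normr_gt0.
  have h3 : `|phi w^-1| <= (D * u + 1) * `|w|.
    have -> : phi w^-1 = w * ((w^-1 * phi w^-1 - -1) - 1) by field.
    rewrite normrM mulrC ler_wpM2r // (le_trans (ler_normB _ _)) // normr1 lerD2r.
    by rewrite (le_trans h2) // ler_wpM2l // ltW.
  have -> : p.[w^-1] / q.[w^-1] = - (phi w^-1 - p.[w^-1] / q.[w^-1]) + phi w^-1 by ring.
  by rewrite (le_trans (ler_normD _ _)) // normrN mulrDl lerD.
pose H := p * B - A * q.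
pose Pi := \prod_(c <- nodes) ('X - c%:P).
have [G [lG GE]] := error_product hab hphi hexp n.+1 0.
have errE m : off_segment alpha beta m -> phi m - T n.+1 0 m = Pi.[m] * G m.
  by move=> hm; rewrite -phi0 GE // prod_nodes; congr (_ * _).
have off_nodes c : c \in nodes -> off_segment alpha beta c.
  move=> /mapP[k _ ->]; rewrite /node.
  by have [? ?] := off_segment_z alpha beta hdelta hz k./2; case: ifP.
have dvdH : Pi %| H.
  apply: dvdp_prod_XsubC => c cn; set m := count_mem c nodes.
  have hc := off_nodes c cn.
  have [|C hC] := agree (Some c); first by rewrite in_cons; apply/orP; right; exact: map_f.
  have [s s0 hs] := dnbhs0_radius hC.
  have cS : count_mem (Some c) (None :: map Some nodes) = m.
    exact: count_mem_Some.
  rewrite cS in hs.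
  have : ('X - c%:P) ^+ m %| Pi.
    by rewrite -mup_geq ?mu_prod_XsubC // monic_neq0 // monic_prod_XsubC.
  move=> /dvdpP[Pi' PiE].
  have [rq rq0 hq] := horner_neq0_near c q0.
  have [d d0 hd] := off_segment_near hc.
  have lqB : lipschitz_at c (fun x => q.[x] * B.[x]).
    by apply: lipschitz_atM; exact: lipschitz_at_horner.
  have lPG : lipschitz_at c (fun x => Pi'.[x] * G x).
    by apply: lipschitz_atM (lG c hc); exact: lipschitz_at_horner.
  have [r1 [M1 [r10 M10 hM1]]] := lipschitz_at_bounded lqB.
  have [r2 [M2 [r20 M20 hM2]]] := lipschitz_at_bounded lPG.
  have [t1 [t10 t1s t1q]] := common_radius s0 rq0.
  have [t2 [t20 t2t t2d]] := common_radius t10 d0.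
  have [t3 [t30 t3t t3r]] := common_radius t20 r10.
  have [t4 [t40 t4t t4r]] := common_radius t30 r20.
  apply: (@dvdp_of_small _ _ c m (M1 * (C + M2)) t4) => // w w0 wt.
  have wE : (c + w) - c = w by ring.
  have qw0 := hq w w0 (t1q _ (t2t _ (t3t _ (t4t _ wt)))).
  have [|hw _] := hd (c + w); first by rewrite wE t2d ?t3t ?t4t.
  have [Bw0 TE] := AB _ hw.
  have -> : H.[c + w] = (q.[c + w] * B.[c + w]) *
      (- (phi (c + w) - r (c + w)) + (phi (c + w) - T n.+1 0 (c + w))).
    rewrite rE // TE /H !(hornerD, hornerN, hornerM); field.
    by rewrite Bw0 qw0.
  rewrite normrM -mulrA; apply: ler_pM => //.
    by apply: hM1; rewrite wE t3r ?t4t.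
  rewrite (le_trans (ler_normD _ _)) // normrN mulrDl lerD //.
    exact: hs w w0 (t1s _ (t2t _ (t3t _ (t4t _ wt)))).
  rewrite errE // PiE hornerM horner_exp hornerXsubC wE mulrAC normrM normrX.
  by rewrite ler_wpM2r ?exprn_ge0 // hM2 // wE t4r.
have H0 : H = 0.
  apply/eqP; apply: contraTT dvdH => H0; apply/negP => /(dvdp_leq H0).
  rewrite /Pi size_prod_XsubC size_map size_iota leqNgt ltnS => /negP; apply.
  rewrite (leq_trans (size_polyD _ _)) // size_polyN geq_max.
  apply/andP; split; rewrite (leq_trans (size_polyMleq _ _)) // -subn1 leq_subLR.
    by rewrite sB (leq_trans (leq_add sp' (leqnn _))) // addnS add1n addnn.
  by rewrite (leq_trans (leq_add sA sq)) // addnS add1n addnn.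
have pBAq : p * B = A * q by apply/eqP; rewrite -subr_eq0 -/H H0.
have Bq : B %| q.
  have := fraction_coprime n.+1 0; rewrite coprimep_sym => /Gauss_dvdpr <-.
  by rewrite -/A -/B -pBAq dvdp_mull.
have qB : B %= q.
  rewrite -(dvdp_size_eqp Bq) eqn_leq sB sq andbT -sB; exact: dvdp_leq.
have [B0 TE] := AB l hl.
have ql : q.[l] != 0 by rewrite -rootE -(eqp_root qB) rootE.
rewrite rE // TE; apply/eqP; rewrite eqr_div // -!hornerM pBAq.
by [].
Qed.

End Uniqueness.

Theorem theorem6p2 (R : realType) (alpha beta : R) (hab : alpha < beta)
    (phi : R[i] -> R[i]) (sigma : probability (measurableTypeR R) R)
    (hphi : represented_by alpha beta sigma phi)
    (hsupp : infinite_set (measure_support sigma))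
    (z : nat -> R[i]) (delta : R) (hdelta : 0 < delta)
    (hz : forall k, delta < complex.Im (z k))
    (phi_ : nat -> R[i] -> R[i]) (a1 a2 b : nat -> R)
    (hexp : step_by_step alpha beta z phi phi_ a1 a2 b) :
  locally_uniformly_cvg (off_segment alpha beta) (convergent z a1 a2 b) phi /\
  (forall f : nat -> R[i] -> R[i],
     (forall n, multipoint_pade (pade_points z) phi n n (f n)) ->
     locally_uniformly_cvg (off_segment alpha beta) f phi).
Proof.
have unif := truncation_locally_uniform hab hphi hexp hdelta hz.
split=> [|f hf]; apply: unif => n l n0 hl.
  by exists n.+1 => //; rewrite -tail_convergent_truncation.
exists n => //; case: n n0 => // n _.
exact: (pade_eq_truncation hab hphi hexp hdelta hz (hf n.+1) hl).
Qed.
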